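(* Let $n\ge 0$ and $\beta\in Q_n^+$. The following are equivalent: (i) for every $\Lambda\in P^+$, the homomorphism $Z(\mathscr{R}_\beta)\to Z(\mathscr{R}_\beta^{\Lambda})$ induced by the canonical surjection $\mathscr{R}_\beta\to\mathscr{R}_\beta^\Lambda$ is surjective (the ''center conjecture'' holds for $\mathscr{R}_\beta^\Lambda$); (ii) for every $\Lambda\in P^+$ and every $i\in I$, the homomorphism $\overline{p}_\beta^{\Lambda,i}: Z(\mathscr{R}_\beta^{\Lambda+\Lambda_i})\to Z(\mathscr{R}_\beta^{\Lambda})$ induced by the canonical surjection $p_\beta^{\Lambda,i}:\mathscr{R}_\beta^{\Lambda+\Lambda_i}\to\mathscr{R}_\beta^{\Lambda}$ is surjective.
   Context: **Cartan datum.** $I$ is an index set and $A=(a_{ij})_{i,j\in I}$ is a symmetrizable generalized Cartan matrix (integral; $a_{ii}=2$; $a_{ij}\le 0$ for $i\ne j$; $a_{ij}=0\Leftrightarrow a_{ji}=0$; there are $d_i\in\mathbb{Z}_{>0}$ with $(d_ia_{ij})$ symmetric). $P$ is a free abelian group of finite rank, $P^\vee=\mathrm{Hom}(P,\mathbb{Z})$ with natural pairing $\langle\cdot,\cdot\rangle:P^\vee\times P\to\mathbb{Z}$; there are linearly independent simple roots $\alpha_i\in P$, simple coroots $\alpha_i^\vee\in P^\vee$ with $\langle\alpha_i^\vee,\alpha_j\rangle=a_{ij}$, and fundamental weights $\Lambda_i\in P$ with $\langle\alpha_j^\vee,\Lambda_i\rangle=\delta_{ij}$. $P^+=\{\lambda\in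 P:\langle\alpha_i^\vee,\lambda\rangle\ge0\ \forall i\}$, $Q^+=\sum_i\mathbb{Z}_{\ge0}\alpha_i$, $Q_n^+=\{\sum_i k_i\alpha_i\in Q^+:\sum_i k_i=n\}$. Put $(\alpha_i,\alpha_j)=d_ia_{ij}$. The symmetric group $\mathfrak{S}_n$ acts on $I^n$ by $w.\nu=(\nu_{w^{-1}(1)},\dots,\nu_{w^{-1}(n)})$; for $\beta\in Q_n^+$, $I^\beta=\{\nu\in I^n:\sum_k\alpha_{\nu_k}=\beta\}$. $s_k=(k,k+1)$. **KLR algebra.** $\mathbf{k}$ is a field. Fix $Q_{i,j}\in\mathbf{k}[u,v]$ with $Q_{i,i}=0$, $Q_{i,j}(u,v)=Q_{j,i}(v,u)$, and for $i\ne j$, $Q_{i,j}(u,v)=\sum_{p,q\ge0}c_{i,j,p,q}u^pv^q$ where $c_{i,j,p,q}=0$ unless $(\alpha_i,\alpha_i)p+(\alpha_j,\alpha_j)q=-2(\alpha_i,\alpha_j)$, and $c_{i,j,-a_{ij},0}\ne0$. For $\beta\in Q_n^+$, $\mathscr{R}_\beta$ is the associative $\mathbf{k}$-algebra generated by $e(\nu)$ ($\nu\in I^\beta$), $x_1,\dots,x_n$, $\tau_1,\dots,\tau_{n-1}$ with relations: $e(\nu)e(\nu')=\delta_{\nu\nu'}e(\nu)$, $\sum_\nu e(\nu)=1$, $x_kx_l=x_lx_k$, $x_ke(\nu)=e(\nu)x_k$, $\tau_le(\nu)=e(s_l.\nu)\tau_l$, $\tau_k\tau_l=\tau_l\tau_k$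 if $|k-l|>1$, $\tau_k^2e(\nu)=Q_{\nu_k,\nu_{k+1}}(x_k,x_{k+1})e(\nu)$; $(\tau_kx_l-x_{s_k(l)}\tau_k)e(\nu)=-e(\nu)$ if $l=k,\nu_k=\nu_{k+1}$, $=e(\nu)$ if $l=k+1,\nu_k=\nu_{k+1}$, and $=0$ otherwise; $(\tau_{k+1}\tau_k\tau_{k+1}-\tau_k\tau_{k+1}\tau_k)e(\nu)=\frac{Q_{\nu_k,\nu_{k+1}}(x_k,x_{k+1})-Q_{\nu_{k+2},\nu_{k+1}}(x_{k+2},x_{k+1})}{x_k-x_{k+2}}e(\nu)$ if $\nu_k=\nu_{k+2}$, and $=0$ otherwise. **Cyclotomic quotient.** For $\Lambda\in P^+$, $\mathscr{R}_\beta^\Lambda=\mathscr{R}_\beta/I_{\Lambda,\beta}$, where $I_{\Lambda,\beta}$ is the two-sided ideal generated by $\sum_{\nu\in I^\beta}x_1^{\langle\alpha_{\nu_1}^\vee,\Lambda\rangle}e(\nu)$ (for $n=0$, $\mathscr{R}_0^\Lambda=\mathbf{k}$). Since $I_{\Lambda+\Lambda_i,\beta}\subset I_{\Lambda,\beta}$, there is a canonical surjection $p_\beta^{\Lambda,i}:\mathscr{R}_\beta^{\Lambda+\Lambda_i}\to\mathscr{R}_\beta^\Lambda$. $Z(-)$ denotes the center. *)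

(* Defs.v *)
From HB Require Import structures.
From mathcomp Require Import all_boot all_order all_algebra all_fingroup.
From mathcomp Require Import mathcomp_extra boolp classical_sets functions.
From mathcomp.multinomials Require Import monalg.

Set Implicit Arguments.
Unset Strict Implicit.
Unset Printing Implicit Defensive.

Import Order.TTheory GRing.Theory Num.Theory.

Local Open Scope classical_set_scope.
Local Open Scope ring_scope.
Local Open Scope quotient_scope.

Section FreeAlgebra.
Variables (K : comNzRingType) (X : choiceType).

Definition freeAlg := {malg K[{fmonom X}]}.

HB.instance Definition _ := GRing.Lalgebra.on freeAlg.

Definition fgen (x : X) : freeAlg := << fmu x >>.

Lemma freeAlg_scalarC (a : K) (w : freeAlg) : a%:MP * w = w * a%:MP.
Proof.
rewrite [w]monalgE mulr_sumr mulr_suml; apply: eq_bigr => m _.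
by rewrite !malgM_def !fgmulUU mul1m mulm1 mulrC.
Qed.
End FreeAlgebra.

Section Ideals.
Variable A : pzRingType.

Record ideal := Ideal {
  ideal_set :> A -> Prop;
  ideal0 : ideal_set 0;
  idealB : forall x y, ideal_set x -> ideal_set y -> ideal_set (x - y);
  idealMl : forall a x, ideal_set x -> ideal_set (a * x);
  idealMr : forall a x, ideal_set x -> ideal_set (x * a)
}.

Lemma idealN (I : ideal) x : I x -> I (- x).
Proof. by move=> Ix; rewrite -sub0r; apply: idealB => //; apply: ideal0. Qed.

Lemma idealD (I : ideal) x y : I x -> I y -> I (x + y).
Proof. by move=> Ix /idealN Iy; rewrite -[y]opprK; apply: idealB. Qed.

Lemma idealBC (I : ideal) x y : I (x - y) -> I (y - x).
Proof. by move=> /idealN; rewrite opprB. Qed.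

Definition ideal_gen_set (S : set A) : set A :=
  [set x | forall I : ideal, S `<=` I -> I x].

Lemma ideal_gen0 (S : set A) : ideal_gen_set S 0.
Proof. by move=> I _; apply: ideal0. Qed.

Lemma ideal_genB (S : set A) x y :
  ideal_gen_set S x -> ideal_gen_set S y -> ideal_gen_set S (x - y).
Proof. by move=> Sx Sy I SI; apply: idealB; [apply: Sx | apply: Sy]. Qed.

Lemma ideal_genMl (S : set A) a x : ideal_gen_set S x -> ideal_gen_set S (a * x).
Proof. by move=> Sx I SI; apply: idealMl; apply: Sx. Qed.

Lemma ideal_genMr (S : set A) a x : ideal_gen_set S x -> ideal_gen_set S (x * a).
Proof. by move=> Sx I SI; apply: idealMr; apply: Sx. Qed.

Definition ideal_gen (S : set A) : ideal :=
  Ideal (@ideal_gen0 S) (@ideal_genB S) (@ideal_genMl S) (@ideal_genMr S).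

Lemma ideal_gen_sub (S : set A) : S `<=` ideal_gen S.
Proof. by move=> x Sx I; apply. Qed.

Lemma ideal_gen_min (S : set A) (I : ideal) : S `<=` I -> ideal_gen S `<=` I.
Proof. by move=> SI x; apply. Qed.

Definition center : set A := [set z | forall a, z * a = a * z].
End Ideals.
Arguments center : clear implicits.

Section Quotient.
Variables (A : pzRingType) (I : ideal A).

Definition ideal_rel (x y : A) := `[< I (x - y) >].

Lemma ideal_rel_refl : reflexive ideal_rel.
Proof. by move=> x; apply/asboolP; rewrite subrr; apply: ideal0. Qed.

Lemma ideal_rel_sym : symmetric ideal_rel.
Proof. by move=> x y; apply/asboolP/asboolP; apply: idealBC. Qed.

Lemma ideal_rel_trans : transitive ideal_rel.
Proof.
move=> y x z /asboolP Ixy /asboolP Iyz; apply/asboolP.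
by rewrite -[x](subrK y) -addrA; apply: idealD.
Qed.

Canonical ideal_equiv :=
  EquivRel ideal_rel ideal_rel_refl ideal_rel_sym ideal_rel_trans.

Definition quot := {eq_quot ideal_equiv}.

HB.instance Definition _ := Choice.on quot.

Definition quot_proj (x : A) : quot := \pi_quot x.

Lemma quot_projP (x y : A) : quot_proj x = quot_proj y <-> I (x - y).
Proof.
rewrite /quot_proj; split => [/eqquotP /asboolP //|Ixy].
by apply/eqquotP/asboolP.
Qed.

Definition quot_repr (q : quot) : A := generic_quotient.repr q.

Lemma quot_reprK q : quot_proj (quot_repr q) = q.
Proof. exact: reprK. Qed.

Lemma quot_repr_proj x : I (quot_repr (quot_proj x) - x).
Proof. by apply/quot_projP; rewrite quot_reprK. Qed.

Definition quot_zero := quot_proj 0.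
Definition quot_one := quot_proj 1.
Definition quot_opp p := quot_proj (- quot_repr p).
Definition quot_add p q := quot_proj (quot_repr p + quot_repr q).
Definition quot_mul p q := quot_proj (quot_repr p * quot_repr q).

Lemma quot_projN x : quot_opp (quot_proj x) = quot_proj (- x).
Proof.
apply/quot_projP; rewrite -opprD; apply: idealN.
exact: quot_repr_proj.
Qed.

Lemma quot_projD x y :
  quot_add (quot_proj x) (quot_proj y) = quot_proj (x + y).
Proof.
apply/quot_projP; rewrite opprD addrACA.
by apply: idealD; apply: quot_repr_proj.
Qed.

Lemma quot_projM x y :
  quot_mul (quot_proj x) (quot_proj y) = quot_proj (x * y).
Proof.
apply/quot_projP; set x' := quot_repr _; set y' := quot_repr _.
have -> : x' * y' - x * y = (x' - x) * y' + x * (y' - y).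
  by rewrite mulrBl mulrBr addrA subrK.
apply: idealD; first by apply: idealMr; apply: quot_repr_proj.
by apply: idealMl; apply: quot_repr_proj.
Qed.

Lemma quotW (P : quot -> Prop) : (forall x, P (quot_proj x)) -> forall q, P q.
Proof. by move=> h q; rewrite -[q]quot_reprK. Qed.

Lemma quot_addA : associative quot_add.
Proof.
by elim/quotW=> x; elim/quotW=> y; elim/quotW=> z; rewrite !quot_projD addrA.
Qed.

Lemma quot_addC : commutative quot_add.
Proof. by elim/quotW=> x; elim/quotW=> y; rewrite !quot_projD addrC. Qed.

Lemma quot_add0 : left_id quot_zero quot_add.
Proof. by elim/quotW=> x; rewrite quot_projD add0r. Qed.

Lemma quot_addN : left_inverse quot_zero quot_opp quot_add.
Proof. by elim/quotW=> x; rewrite quot_projN quot_projD addNr. Qed.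

HB.instance Definition _ :=
  GRing.isZmodule.Build quot quot_addA quot_addC quot_add0 quot_addN.

Lemma quot_mulA : associative quot_mul.
Proof.
by elim/quotW=> x; elim/quotW=> y; elim/quotW=> z; rewrite !quot_projM mulrA.
Qed.

Lemma quot_mul1l : left_id quot_one quot_mul.
Proof. by elim/quotW=> x; rewrite quot_projM mul1r. Qed.

Lemma quot_mul1r : right_id quot_one quot_mul.
Proof. by elim/quotW=> x; rewrite quot_projM mulr1. Qed.

Lemma quot_mulDl : left_distributive quot_mul quot_add.
Proof.
elim/quotW=> x; elim/quotW=> y; elim/quotW=> z.
by rewrite !(quot_projM, quot_projD) mulrDl.
Qed.

Lemma quot_mulDr : right_distributive quot_mul quot_add.
Proof.
elim/quotW=> x; elim/quotW=> y; elim/quotW=> z.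
by rewrite !(quot_projM, quot_projD) mulrDr.
Qed.

HB.instance Definition _ := GRing.Zmodule_isPzRing.Build quot
  quot_mulA quot_mul1l quot_mul1r quot_mulDl quot_mulDr.

Lemma quot_proj_zmod_morphism : zmod_morphism quot_proj.
Proof. by move=> x y; rewrite -quot_projD -quot_projN. Qed.

Lemma quot_proj_monoid_morphism : monoid_morphism quot_proj.
Proof. by split=> // x y; rewrite -quot_projM. Qed.

HB.instance Definition _ :=
  GRing.isZmodMorphism.Build A quot quot_proj quot_proj_zmod_morphism.
HB.instance Definition _ :=
  GRing.isMonoidMorphism.Build A quot quot_proj quot_proj_monoid_morphism.

Lemma quot_proj_surj : set_surj setT setT quot_proj.
Proof. by move=> q _; exists (quot_repr q); rewrite ?quot_reprK. Qed.
End Quotient.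

Section QuotientMap.
Variables (A : pzRingType) (I J : ideal A).

Definition quot_map of I `<=` J := fun q : quot I => quot_proj J (quot_repr q).

Variable sIJ : I `<=` J.

Lemma quot_mapE x : quot_map sIJ (quot_proj I x) = quot_proj J x.
Proof. by apply/quot_projP; apply: sIJ; apply: quot_repr_proj. Qed.

Lemma quot_map_zmod_morphism : zmod_morphism (quot_map sIJ).
Proof.
by elim/quotW=> x; elim/quotW=> y; rewrite -raddfB !quot_mapE raddfB.
Qed.

Lemma quot_map_monoid_morphism : monoid_morphism (quot_map sIJ).
Proof.
split; first by rewrite -(rmorph1 (quot_proj I)) quot_mapE rmorph1.
by elim/quotW=> x; elim/quotW=> y; rewrite -rmorphM !quot_mapE rmorphM.
Qed.

HB.instance Definition _ := GRing.isZmodMorphism.Build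
  (quot I) (quot J) (quot_map sIJ) quot_map_zmod_morphism.
HB.instance Definition _ := GRing.isMonoidMorphism.Build
  (quot I) (quot J) (quot_map sIJ) quot_map_monoid_morphism.

Lemma quot_map_surj : set_surj setT setT (quot_map sIJ).
Proof. by elim/quotW=> x _; exists (quot_proj I x); rewrite ?quot_mapE. Qed.
End QuotientMap.

Lemma center_fun (A B : pzRingType) (f : {rmorphism A -> B}) :
  set_surj setT setT f -> set_fun (center A) (center B) f.
Proof.
move=> fS z Zz b; have [a _ <-] := fS b I.
by rewrite -!rmorphM Zz.
Qed.

Record cartan_datum := CartanDatum {
  (* the independence of the simple roots in a lattice of finite rank forces
     the index set to be finite *)
  idx : finType;
  wt : zmodType;
  wt_free : exists r (f : {additive wt -> 'rV[int]_r}), bijective f;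
  cmat : idx -> idx -> int;
  cmat_diag : forall i, cmat i i = 2;
  cmat_off : forall i j, i != j -> cmat i j <= 0;
  cmat_zero : forall i j, cmat i j = 0 <-> cmat j i = 0;
  symd : idx -> int;
  symd_gt0 : forall i, 0 < symd i;
  symd_sym : forall i j, symd i * cmat i j = symd j * cmat j i;
  sroot : idx -> wt;
  sroot_indep : forall c : idx -> int,
    \sum_i sroot i *~ c i = 0 -> forall i, c i = 0;
  coroot : idx -> {additive wt -> int};
  coroot_sroot : forall i j, coroot i (sroot j) = cmat i j;
  fweight : idx -> wt;
  coroot_fweight : forall i j, coroot j (fweight i) = (i == j)%:R
}.

Section RootData.
Variable D : cartan_datum.

Definition root_form (i j : idx D) : int := symd i * cmat i j.

Definition dominant (L : wt D) := forall i, 0 <= coroot i L.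

Definition Qplus (n : nat) (b : wt D) :=
  exists2 k : idx D -> nat,
    b = \sum_i sroot i *+ k i & (\sum_i k i = n)%N.

Lemma dominant_fweightD (L : wt D) (i : idx D) :
  dominant L -> dominant (L + fweight i).
Proof. by move=> dL j; rewrite raddfD /= coroot_fweight addr_ge0. Qed.

Section Sequences.
Variable n : nat.

Definition wt_seq (nu : n.-tuple (idx D)) : wt D :=
  \sum_(k < n) sroot (tnth nu k).

Definition perm_seq (w : 'S_n) (nu : n.-tuple (idx D)) : n.-tuple (idx D) :=
  [tuple tnth nu ((w^-1)%g k) | k < n].

Lemma wt_perm_seq w nu : wt_seq (perm_seq w nu) = wt_seq nu.
Proof.
rewrite /wt_seq (reindex_inj (@perm_inj _ w)); apply: eq_bigr => k _.
by rewrite tnth_mktuple permK.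
Qed.

Definition seqs_of (b : wt D) := {nu : n.-tuple (idx D) | wt_seq nu == b}.

Lemma perm_seqs_subproof b w (nu : seqs_of b) :
  wt_seq (perm_seq w (val nu)) == b.
Proof. by rewrite wt_perm_seq (valP nu). Qed.

Definition perm_seqs b (w : 'S_n) (nu : seqs_of b) : seqs_of b :=
  exist _ (perm_seq w (val nu)) (perm_seqs_subproof w nu).
End Sequences.
End RootData.

(* u is the inner variable and v the outer one: f`_q`_p is the coefficient
   of u ^ p v ^ q *)
Record klr_datum (D : cartan_datum) (K : fieldType) := KlrDatum {
  Qpoly :> idx D -> idx D -> {poly {poly K}};
  Qpoly_diag : forall i, Qpoly i i = 0;
  Qpoly_sym : forall i j, Qpoly i j = swapXY (Qpoly j i);
  Qpoly_homog : forall i j p q, i != j -> (Qpoly i j)`_q`_p != 0 ->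
    root_form i i * p%:Z + root_form j j * q%:Z = - 2 * root_form i j;
  Qpoly_lead : forall i j, i != j -> (Qpoly i j)`_0`_`|cmat i j|%N != 0
}.

Section Evaluation.
Variables (K : fieldType) (A : lalgType K).
Implicit Types (f : {poly {poly K}}) (u v w : A).

Definition eval2 f u v : A :=
  \sum_(q < size f) \sum_(p < size f`_q) f`_q`_p *: (u ^+ p * v ^+ q).

(* the value at commuting u, v, w of the polynomial
   (f(u, v) - f(w, v)) / (u - w); see eval2_divdiff *)
Definition divdiff f u v w : A :=
  \sum_(q < size f) \sum_(p < size f`_q)
    f`_q`_p *: ((\sum_(r < p) u ^+ (p.-1 - r) * w ^+ r) * v ^+ q).

End Evaluation.

Lemma eval2_divdiff (K : fieldType) (A : algType K) f (u v w : A) :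
  GRing.comm u w -> (u - w) * divdiff f u v w = eval2 f u v - eval2 f w v.
Proof.
move=> cuw; rewrite -sumrB mulr_sumr; apply: eq_bigr => q _.
rewrite -sumrB mulr_sumr; apply: eq_bigr => p _.
by rewrite -scalerAr mulrA -subrXX_comm // -scalerBr mulrBl.
Qed.

Section Positions.
Variable n : nat.
Implicit Type k : 'I_n.-1.

Lemma pos1_subproof k : (k.+1 < n)%N.
Proof. by rewrite -ltn_predRL. Qed.

Definition pos k : 'I_n := widen_ord (leq_pred n) k.
Definition pos1 k : 'I_n := Ordinal (pos1_subproof k).
Definition stransp k : 'S_n := tperm (pos k) (pos1 k).
End Positions.

Section KLR.
Variables (D : cartan_datum) (K : fieldType) (Q : klr_datum D K).
Variables (n : nat) (b : wt D).

Definition klr_gen := (seqs_of n b + 'I_n + 'I_n.-1)%type.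

HB.instance Definition _ := Choice.on klr_gen.

Definition klr_free := freeAlg K klr_gen.

Definition fe (nu : seqs_of n b) : klr_free := fgen K (inl (inl nu) : klr_gen).
Definition fx (k : 'I_n) : klr_free := fgen K (inl (inr k) : klr_gen).
Definition ft (k : 'I_n.-1) : klr_free := fgen K (inr k : klr_gen).
Definition color (nu : seqs_of n b) (k : 'I_n) : idx D := tnth (val nu) k.

Inductive klr_rel : klr_free -> klr_free -> Prop :=
| rel_ee nu mu : klr_rel (fe nu * fe mu) (if nu == mu then fe nu else 0)
| rel_sum_e : klr_rel (\sum_nu fe nu) 1
| rel_xx k l : klr_rel (fx k * fx l) (fx l * fx k)
| rel_xe k nu : klr_rel (fx k * fe nu) (fe nu * fx k)
| rel_te l nu : klr_rel (ft l * fe nu) (fe (perm_seqs (stransp l) nu) * ft l)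
| rel_tt (k l : 'I_n.-1) : (k.+1 < l)%N || (l.+1 < k)%N ->
    klr_rel (ft k * ft l) (ft l * ft k)
| rel_t2 k nu :
    klr_rel (ft k ^+ 2 * fe nu)
      (eval2 (Q (color nu (pos k)) (color nu (pos1 k)))
         (fx (pos k)) (fx (pos1 k)) * fe nu)
| rel_tx k l nu :
    klr_rel ((ft k * fx l - fx (stransp k l) * ft k) * fe nu)
      (if color nu (pos k) == color nu (pos1 k) then
         if l == pos k then - fe nu else if l == pos1 k then fe nu else 0
       else 0)
| rel_braid (k k1 : 'I_n.-1) nu : k1 = k.+1 :> nat ->
    klr_rel ((ft k1 * ft k * ft k1 - ft k * ft k1 * ft k) * fe nu)
      (if color nu (pos k) == color nu (pos1 k1) then
         divdiff (Q (color nu (pos k)) (color nu (pos k1)))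
           (fx (pos k)) (fx (pos k1)) (fx (pos1 k1)) * fe nu
       else 0).

Definition klr_ideal : ideal klr_free :=
  ideal_gen [set p | exists f g, klr_rel f g /\ p = f - g].

Definition KLR := quot klr_ideal.

HB.instance Definition _ := GRing.PzRing.on KLR.

Definition klr_proj : klr_free -> KLR := quot_proj klr_ideal.

HB.instance Definition _ := GRing.RMorphism.on klr_proj.

Lemma klr_relP f g : klr_rel f g -> klr_proj f = klr_proj g.
Proof. by move=> fg; apply/quot_projP/ideal_gen_sub; exists f, g. Qed.

(* the structure map that makes KLR a K-algebra *)
Definition klr_scalar (c : K) : KLR := klr_proj c%:MP.

Lemma klr_scalar_center c : center KLR (klr_scalar c).
Proof. by elim/quotW=> f; rewrite -!rmorphM freeAlg_scalarC. Qed.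

Definition klr_e (nu : seqs_of n b) : KLR := klr_proj (fe nu).
Definition klr_x (k : 'I_n) : KLR := klr_proj (fx k).
Definition klr_t (k : 'I_n.-1) : KLR := klr_proj (ft k).

(* The absolute value turns <coroot, L> into an exponent; it is the identity
   for dominant L.  For n = 0 there is no x_1 and the ideal is zero.          *)
Definition cyc_gen (L : wt D) : set KLR :=
  [set g | exists n_gt0 : (0 < n)%N, let o := Ordinal n_gt0 in
     g = \sum_nu klr_x o ^+ `|coroot (color nu o) L|%N * klr_e nu].

Definition cyc_ideal (L : wt D) : ideal KLR := ideal_gen (cyc_gen L).

Definition cycKLR (L : wt D) := quot (cyc_ideal L).

HB.instance Definition _ L := GRing.PzRing.on (cycKLR L).

Definition cyc_proj (L : wt D) : KLR -> cycKLR L := quot_proj (cyc_ideal L).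

HB.instance Definition _ L := GRing.RMorphism.on (cyc_proj L).

Lemma klr_ee nu mu : klr_e nu * klr_e mu = if nu == mu then klr_e nu else 0.
Proof.
rewrite /klr_e -(rmorphM klr_proj) /=.
rewrite [LHS](klr_relP (rel_ee nu mu)).
by case: ifP => // _; rewrite rmorph0.
Qed.

Lemma klr_xe k nu : klr_x k * klr_e nu = klr_e nu * klr_x k.
Proof.
rewrite /klr_e /klr_x -!(rmorphM klr_proj) /=.
exact: klr_relP (rel_xe k nu).
Qed.

Lemma klr_Xe k m nu : klr_x k ^+ m * klr_e nu = klr_e nu * klr_x k ^+ m.
Proof. by apply/commr_sym/commrX/commr_sym/klr_xe. Qed.

Lemma cyc_ideal_fweightD (L : wt D) (i : idx D) :
  dominant L -> cyc_ideal (L + fweight i) `<=` cyc_ideal L.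
Proof.
move=> dL; apply: ideal_gen_min => g [n_gt0 /= ->]; set o := Ordinal n_gt0.
pose h := \sum_nu klr_x o ^+ (i == color nu o) * klr_e nu.
pose g0 := \sum_nu klr_x o ^+ `|coroot (color nu o) L|%N * klr_e nu.
suff -> : \sum_nu klr_x o ^+ `|coroot (color nu o) (L + fweight i)%R|%N * klr_e nu
          = h * g0.
  by apply: (@idealMl _ (cyc_ideal L)); apply: ideal_gen_sub; exists n_gt0.
rewrite /h mulr_suml; apply: eq_bigr => nu _.
rewrite /g0 mulr_sumr (bigD1 nu) //= big1 ?addr0 => [|mu mu_nu].
  rewrite mulrA -[_ * _ * klr_x o ^+ _]mulrA -klr_Xe mulrA -exprD -mulrA.
  rewrite klr_ee eqxx raddfD /= coroot_fweight addnC; congr (_ ^+ _ * _).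
  by have := dL (color nu o); case: (coroot _ _) => // m _; case: eqP.
rewrite mulrA -[_ * _ * klr_x o ^+ _]mulrA -klr_Xe mulrA -mulrA klr_ee.
by rewrite [nu == mu]eq_sym (negbTE mu_nu) mulr0.
Qed.

Definition cyc_trans (L : wt D) (dL : dominant L) (i : idx D) :
    cycKLR (L + fweight i) -> cycKLR L :=
  quot_map (cyc_ideal_fweightD (i := i) dL).

Arguments cyc_trans {L} dL i q.

HB.instance Definition _ L dL i := GRing.RMorphism.on (@cyc_trans L dL i).

Lemma cyc_transE (L : wt D) (dL : dominant L) i a :
  cyc_trans dL i (cyc_proj (L + fweight i) a) = cyc_proj L a.
Proof. exact: quot_mapE. Qed.

(* cyc_proj and cyc_trans restrict to maps between the centers. *)
Lemma cyc_proj_center L :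
  set_fun (center KLR) (center (cycKLR L)) (cyc_proj L).
Proof. by apply: (center_fun (f := cyc_proj L)); apply: quot_proj_surj. Qed.

Lemma cyc_trans_center L (dL : dominant L) i :
  set_fun (center (cycKLR (L + fweight i))) (center (cycKLR L)) (cyc_trans dL i).
Proof. by apply: (center_fun (f := cyc_trans dL i)); apply: quot_map_surj. Qed.
End KLR.

Arguments klr_e {D K} Q {n b} nu.
Arguments klr_x {D K} Q {n} b k.
Arguments klr_t {D K} Q {n} b k.
Arguments cyc_proj {D K} Q n b L a.
Arguments cyc_trans {D K} Q n b {L} dL i q.

(* Main.v *)
Require Import Defs.
From HB Require Import structures.
From mathcomp Require Import all_boot all_order all_algebra all_fingroup.
From mathcomp Require Import mathcomp_extra boolp classical_sets functions.
From mathcomp.multinomials Require Import monalg xfinmap.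
From mathcomp Require Import zify ring.

Set Implicit Arguments.
Unset Strict Implicit.
Unset Printing Implicit Defensive.

Import Order.TTheory GRing.Theory Num.Theory.

Local Open Scope ring_scope.

(** Grade the KLR algebra R by giving x_k e(nu) and tau_k e(nu) their usual
    degrees.  The cyclotomic ideals are homogeneous, R is bounded below in
    degree, and the generator of the ideal of L sits in degrees that grow with
    the pairings of L with the coroots; hence the ideal of a large weight
    contains nothing in low degrees.

    One direction of the equivalence is a factorization: the projection to the
    quotient of level L passes through level L + fweight i.  For the other one,
    let q be central at level L, with a representative a that lives in degrees
    at most M.  Lifting along fundamental weights gives a', central at a level
    L' as large as desired, with a' - a in the ideal of L ([lift_central]).
    Truncate a' to degrees at most M.  Truncation fixes a and preserves the
    homogeneous ideal of L, so the truncation z still represents q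
    ([ideal_gen_trunc]).  The commutator of z with a homogeneous generator of
    degree d is the truncation to degrees at most M + d of the commutator of
    a', which lies in the ideal of L' and therefore in degrees above M + d: it
    vanishes, and z is central in R itself ([trunc_center]).

    Two facts about R carry the argument.

    The grading exists.  It is encoded as a coaction, a ring morphism from R
    that sends a homogeneous r of degree d to r times the shift by d.  Laurent
    polynomials over R would be the usual target; here it is the ring of
    additive endomorphisms of the functions from the integers to R, in which
    multiplications by elements of R and shifts play the same role, and
    truncation is the value at the Heaviside function.  The morphism exists
    because every defining relation becomes homogeneous once it is multiplied
    by an idempotent e(nu) ([coact_rel]).

    R is bounded below ([all_deg_ge]).  If R_q is the subring generated by the
    scalars, the e(nu), the x_k and the tau_k with k < q, then R_(q+1) is the
    sum of R_q and the R_q * tau_q tau_(q-1) ... tau_j ([upto_desc_span]).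
    Unwinding this, finitely many products of tau's span R over its polynomial
    part, which has nonnegative degrees. *)

(** * The ring of additive endomorphisms *)
Section EndomorphismRing.
Variable V : zmodType.

Record endo := Endo { endo_fun :> V -> V; endo_zmod : zmod_morphism endo_fun }.

HB.instance Definition _ := gen_eqMixin endo.
HB.instance Definition _ := gen_choiceMixin endo.
HB.instance Definition _ (f : endo) :=
  GRing.isZmodMorphism.Build V V f (endo_zmod f).

Lemma endoP (f g : endo) : (forall v, f v = g v) -> f = g.
Proof.
case: f g => [f af] [g ag] /= /funext fg; case: g / fg ag => ag.
by congr Endo; apply: Prop_irrelevance.
Qed.

Fact endo0_zmod : zmod_morphism (fun _ : V => 0 : V).
Proof. by move=> u v; rewrite subr0. Qed.
Fact endo1_zmod : zmod_morphism (fun v : V => v).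
Proof. by []. Qed.
Fact endoN_zmod (f : endo) : zmod_morphism (fun v : V => - f v).
Proof. by move=> u v; rewrite raddfB opprB opprK addrC. Qed.
Fact endoD_zmod (f g : endo) : zmod_morphism (fun v : V => f v + g v).
Proof. by move=> u v; rewrite !raddfB opprD addrACA. Qed.
Fact endoM_zmod (f g : endo) : zmod_morphism (fun v : V => f (g v)).
Proof. by move=> u v; rewrite !raddfB. Qed.

Definition endo0 := Endo endo0_zmod.
Definition endo1 := Endo endo1_zmod.
Definition endoN f := Endo (endoN_zmod f).
Definition endoD f g := Endo (endoD_zmod f g).
Definition endoM f g := Endo (endoM_zmod f g).

Fact endo_addA : associative endoD.
Proof. by move=> f g h; apply: endoP => v; apply: addrA. Qed.
Fact endo_addC : commutative endoD.
Proof. by move=> f g; apply: endoP => v; apply: addrC. Qed.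
Fact endo_add0 : left_id endo0 endoD.
Proof. by move=> f; apply: endoP => v; apply: add0r. Qed.
Fact endo_addN : left_inverse endo0 endoN endoD.
Proof. by move=> f; apply: endoP => v; apply: addNr. Qed.

HB.instance Definition _ :=
  GRing.isZmodule.Build endo endo_addA endo_addC endo_add0 endo_addN.

Fact endo_mulA : associative endoM.
Proof. by move=> f g h; apply: endoP. Qed.
Fact endo_mul1l : left_id endo1 endoM.
Proof. by move=> f; apply: endoP. Qed.
Fact endo_mul1r : right_id endo1 endoM.
Proof. by move=> f; apply: endoP. Qed.
Fact endo_mulDl : left_distributive endoM endoD.
Proof. by move=> f g h; apply: endoP. Qed.
Fact endo_mulDr : right_distributive endoM endoD.
Proof. by move=> f g h; apply: endoP => v; apply: raddfD. Qed.

HB.instance Definition _ := GRing.Zmodule_isPzRing.Build endo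
  endo_mulA endo_mul1l endo_mul1r endo_mulDl endo_mulDr.
End EndomorphismRing.

(** Left multiplications and shifts on the functions from the integers to R
    generate a copy of the Laurent polynomials over R: [lmul r * shift a] is the
    monomial of degree a with coefficient r. *)
Section Shifts.
Variable R : pzRingType.

Local Notation V := (int -> R).

Fact lmul_zmod (r : R) : zmod_morphism (fun (v : V) d => r * v d).
Proof. by move=> u v; apply/funext => d; rewrite /= mulrBr. Qed.
Fact shift_zmod (a : int) : zmod_morphism (fun (v : V) d => v (d - a)).
Proof. by []. Qed.

Definition lmul r : endo V := Endo (lmul_zmod r).
Definition shift a : endo V := Endo (shift_zmod a).

Fact lmul_zmod_morphism : zmod_morphism lmul.
Proof. by move=> r s; apply: endoP => v; apply/funext => d; apply: mulrBl. Qed.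
Fact lmul_monoid_morphism : monoid_morphism lmul.
Proof.
split=> [|r s]; apply: endoP => v; apply/funext => d; first exact: mul1r.
by rewrite /= mulrA.
Qed.

HB.instance Definition _ :=
  GRing.isZmodMorphism.Build R (endo V) lmul lmul_zmod_morphism.
HB.instance Definition _ :=
  GRing.isMonoidMorphism.Build R (endo V) lmul lmul_monoid_morphism.

Lemma shift0 : shift 0 = 1.
Proof. by apply: endoP => v; apply/funext => d; rewrite /= subr0. Qed.

Lemma shiftD a b : shift (a + b) = shift a * shift b.
Proof.
by apply: endoP => v; apply/funext => d; rewrite /= opprD addrA.
Qed.

Lemma shift_lmul a r : shift a * lmul r = lmul r * shift a.
Proof. exact: endoP. Qed.
End Shifts.

(** * Morphisms out of free algebras and quotients *)
Section FreeAlgebraLift.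
Variables (K : comNzRingType) (X : choiceType) (S : pzRingType).
Variables (s : {rmorphism K -> S}) (g : X -> S).
(* The target carries no algebra structure: s plays the role of the structure
   map, and it only has to commute with the values on the generators. *)
Hypothesis sC : forall c x, GRing.comm (s c) (g x).

Definition word_val (m : {fmonom X}) : S := \prod_(x <- (m : seq X)) g x.

Definition free_lift (w : freeAlg K X) : S :=
  \sum_(m <- msupp w) s w@_m * word_val m.

Lemma free_liftEw (E : {fset {fmonom X}}) w : (msupp w `<=` E)%fset ->
  free_lift w = \sum_(m <- E) s w@_m * word_val m.
Proof.
move=> le; rewrite [LHS](big_fset_incl _ le) // => m _ /mcoeff_outdom ->.
by rewrite raddf0 mul0r.
Qed.

Lemma free_lift_zmod : zmod_morphism free_lift.
Proof.
move=> v w; have sv := @fsubsetUl _ (msupp v) (msupp w).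
rewrite (free_liftEw sv) (free_liftEw (@fsubsetUr _ (msupp v) (msupp w))).
rewrite (@free_liftEw (msupp v `|` msupp w)%fset) ?msuppB_le //.
by rewrite -sumrB; apply: eq_bigr => m _; rewrite mcoeffB raddfB /= mulrBl.
Qed.

HB.instance Definition _ :=
  GRing.isZmodMorphism.Build (freeAlg K X) S free_lift free_lift_zmod.

Lemma free_liftU c m : free_lift << c *g m >> = s c * word_val m.
Proof. by rewrite (free_liftEw msuppU_le) big_seq_fset1 mcoeffUU. Qed.

Lemma free_liftC c : free_lift c%:MP = s c.
Proof. by rewrite free_liftU /word_val fm1 big_nil mulr1. Qed.

Lemma free_lift_gen x : free_lift (fgen K x) = g x.
Proof. by rewrite free_liftU /word_val fmU big_seq1 rmorph1 mul1r. Qed.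

Lemma free_lift_monoid : monoid_morphism free_lift.
Proof.
split=> [|v w]; first by rewrite free_liftC rmorph1.
rewrite malgME raddf_sum mulr_suml /=; apply: eq_bigr => i _.
rewrite raddf_sum mulr_sumr /=; apply: eq_bigr => j _.
rewrite free_liftU rmorphM -!mulrA; congr (_ * _).
have sm : GRing.comm (s w@_j) (word_val i).
  by apply: commr_prod => x _; apply: sC.
by rewrite [word_val i * _]mulrA -sm -mulrA /word_val fmM big_cat.
Qed.

HB.instance Definition _ :=
  GRing.isMonoidMorphism.Build (freeAlg K X) S free_lift free_lift_monoid.
End FreeAlgebraLift.

Lemma freeAlg_ind (K : comNzRingType) (X : choiceType)
    (P : freeAlg K X -> Prop) :
  (forall c, P c%:MP) -> (forall x, P (fgen K x)) ->
  (forall v w, P v -> P w -> P (v + w)) ->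
  (forall v w, P v -> P w -> P (v * w)) -> forall w, P w.
Proof.
move=> PC Pg PD PM w; rewrite [w]monalgE; apply: (big_ind P) => //.
  by have := PC 0; rewrite raddf0.
move=> m _; have -> : << w@_m *g m >> = (w@_m)%:MP * << m >> :> freeAlg K X.
  by rewrite malgM_def fgmulUU mul1m mulr1.
apply: (PM); first exact: PC.
case: m => s; elim: s => [|x s IHs].
  by have := PC 1; rewrite -(fmE [::]).
have -> : << FMonom (x :: s) >> = fgen K x * << FMonom s >> :> freeAlg K X.
  rewrite malgM_def fgmulUU mulr1; congr << _ >>; apply/eqP.
  by rewrite fmP fmM fmU.
exact: PM.
Qed.

Section QuotLift.
Variables (A S : pzRingType) (I : ideal A) (f : {rmorphism A -> S}).
Hypothesis fI : forall x, I x -> f x = 0.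

Definition quot_lift (q : quot I) : S := f (quot_repr q).

Lemma quot_liftE x : quot_lift (quot_proj I x) = f x.
Proof. by apply/subr0_eq; rewrite -rmorphB fI //; apply: quot_repr_proj. Qed.

Lemma quot_lift_zmod : zmod_morphism quot_lift.
Proof.
elim/quotW=> x; elim/quotW=> y.
by rewrite -(raddfB (quot_proj I)) !quot_liftE raddfB.
Qed.

Lemma quot_lift_monoid : monoid_morphism quot_lift.
Proof.
split; first by rewrite -(rmorph1 (quot_proj I)) quot_liftE rmorph1.
elim/quotW=> x; elim/quotW=> y.
by rewrite -(rmorphM (quot_proj I)) !quot_liftE rmorphM.
Qed.

HB.instance Definition _ :=
  GRing.isZmodMorphism.Build (quot I) S quot_lift quot_lift_zmod.
HB.instance Definition _ :=
  GRing.isMonoidMorphism.Build (quot I) S quot_lift quot_lift_monoid.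

Definition quot_lift_morph : {rmorphism quot I -> S} := quot_lift.
End QuotLift.

Lemma ideal_gen_ker (A S : pzRingType) (f : {rmorphism A -> S}) (G : set A) :
  (forall x, G x -> f x = 0) -> forall x, ideal_gen G x -> f x = 0.
Proof.
move=> fG x Gx; have f0 : f 0 = 0 by exact: raddf0.
have fB u v : f u = 0 -> f v = 0 -> f (u - v) = 0.
  by move=> fu fv; rewrite raddfB /= fu fv subr0.
have fMl a u : f u = 0 -> f (a * u) = 0.
  by move=> fu; rewrite rmorphM /= fu mulr0.
have fMr a u : f u = 0 -> f (u * a) = 0.
  by move=> fu; rewrite rmorphM /= fu mul0r.
exact: (Gx (Ideal f0 fB fMl fMr)).
Qed.

(** * Gradings given by coactions *)
Section Coaction.
Variables (R : pzRingType) (delta : {rmorphism R -> endo (int -> R)}).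
Implicit Types (r s h : R) (c d M N : int).

(** Homogeneous of degree d for the grading encoded by the coaction delta. *)
Definition homog d r := delta r = lmul r * shift R d.

Definition heaviside d : R := if 0 <= d then 1 else 0.

(** If r is the sum of its components r_d, then delta r applied to a function v
    takes at M the value of the sum of the r_d * v (M - d).  At the Heaviside
    function only the components with d <= M survive. *)
Definition trunc M r : R := delta r heaviside M.

Lemma homogN d r : homog d r -> homog d (- r).
Proof. by rewrite /homog => hr; rewrite !raddfN /= hr mulNr. Qed.

Lemma homog1 : homog 0 1.
Proof. by rewrite /homog !rmorph1 shift0 mulr1. Qed.

Lemma homogM c d r s : homog c r -> homog d s -> homog (c + d) (r * s).
Proof.
rewrite /homog => hr hs; rewrite !rmorphM /= hr hs shiftD -!mulrA.
by congr (_ * _); rewrite mulrA shift_lmul -mulrA.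
Qed.

Fact trunc_zmod M : zmod_morphism (trunc M).
Proof. by move=> r s; rewrite /trunc raddfB. Qed.

HB.instance Definition _ M :=
  GRing.isZmodMorphism.Build R R (trunc M) (trunc_zmod M).

Lemma trunc_homog M d r : homog d r -> trunc M r = if d <= M then r else 0.
Proof.
rewrite /homog /trunc => ->; rewrite /= /heaviside subr_ge0.
by case: ifP => _; rewrite ?mulr1 ?mulr0.
Qed.

Inductive deg_ge c : R -> Prop :=
| deg_ge0 : deg_ge c 0
| deg_ge_cons d r s : c <= d -> homog d r -> deg_ge c s -> deg_ge c (r + s).

Lemma deg_ge_homog c d r : c <= d -> homog d r -> deg_ge c r.
Proof.
by move=> cd hr; rewrite -[r]addr0; apply: deg_ge_cons hr (deg_ge0 c).
Qed.

Lemma deg_geD c r s : deg_ge c r -> deg_ge c s -> deg_ge c (r + s).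
Proof.
by move=> fr fs; elim: fr => [|d u v cd hu _ IH]; rewrite ?add0r // -addrA;
  apply: deg_ge_cons hu IH.
Qed.

Lemma deg_geN c r : deg_ge c r -> deg_ge c (- r).
Proof.
elim=> [|d u v cd hu _ IH]; first by rewrite oppr0; apply: deg_ge0.
by rewrite opprD; apply: deg_ge_cons (homogN hu) IH.
Qed.

Lemma deg_ge_le c c' r : c' <= c -> deg_ge c r -> deg_ge c' r.
Proof.
move=> cc; elim=> [|d u v cd hu _ IH]; first exact: deg_ge0.
by apply: deg_ge_cons hu IH; apply: le_trans cd.
Qed.

Lemma deg_geM c c' r s : deg_ge c r -> deg_ge c' s -> deg_ge (c + c') (r * s).
Proof.
move=> fr fs; elim: fr => [|d u v cd hu _ IH].
  by rewrite mul0r; apply: deg_ge0.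
rewrite mulrDl; apply: deg_geD => //; elim: fs => [|d' u' v' cd' hu' _ IH'].
  by rewrite mulr0; apply: deg_ge0.
by rewrite mulrDr; apply: deg_ge_cons (homogM hu hu') IH'; apply: lerD.
Qed.

Lemma deg_ge_sum c (I : Type) (l : seq I) (P : pred I) (f : I -> R) :
  (forall i, P i -> deg_ge c (f i)) -> deg_ge c (\sum_(i <- l | P i) f i).
Proof.
move=> hf; apply: (big_ind (deg_ge c)) => //; first exact: deg_ge0.
exact: deg_geD.
Qed.

Lemma trunc_below c M r : deg_ge c r -> M < c -> trunc M r = 0.
Proof.
move=> fr Mc; elim: fr => [|d u v cd hu _ IH]; first exact: raddf0.
rewrite raddfD /= IH addr0 (trunc_homog M hu) ifN // -ltNge.
exact: lt_le_trans cd.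
Qed.

Lemma trunc_above c r : deg_ge c r -> exists M, trunc M r = r.
Proof.
move=> fr; suff [N hN] : exists N, forall M, N <= M -> trunc M r = r.
  by exists N; apply: hN.
elim: fr => [|d u v cd hu _ [N hN]].
  by exists 0 => M _; apply: raddf0.
exists (Num.max d N) => M; rewrite ge_max => /andP[dM NM].
by rewrite raddfD /= (hN M) // (trunc_homog M hu) dM.
Qed.

Lemma truncMl c d M h r : homog d h -> deg_ge c r ->
  trunc M (h * r) = h * trunc (M - d) r.
Proof.
move=> hh; elim=> [|d' u v cd hu _ IH]; first by rewrite mulr0 !raddf0 mulr0.
rewrite mulrDr !raddfD /= IH mulrDr (trunc_homog _ hu).
rewrite (trunc_homog _ (homogM hh hu)) addrC lerBrDl addrC.
by case: ifP; rewrite ?mulr0.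
Qed.

Lemma truncMr c d M h r : homog d h -> deg_ge c r ->
  trunc M (r * h) = trunc (M - d) r * h.
Proof.
move=> hh; elim=> [|d' u v cd hu _ IH]; first by rewrite mul0r !raddf0 mul0r.
rewrite mulrDl !raddfD /= IH mulrDl (trunc_homog _ hu).
rewrite (trunc_homog _ (homogM hu hh)) lerBrDr.
by case: ifP; rewrite ?mul0r.
Qed.

Section Bounded.
Variable c0 : int.
Hypothesis all_deg_ge : forall r, deg_ge c0 r.

(** The elements all of whose multiples a * s * a' lie in degrees at least
    c0 + N + c0 form an ideal; it contains G because a and a' lie in degrees at
    least c0. *)
Lemma ideal_gen_deg_ge (G : set R) N :
    (forall g, G g -> deg_ge N g) ->
  forall r, ideal_gen G r -> deg_ge (c0 + N + c0) r.
Proof.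
move=> fG r Gr.
pose J : set R := fun s => forall a a', deg_ge (c0 + N + c0) (a * s * a').
have J0 : J 0 by move=> a a'; rewrite mulr0 mul0r; apply: deg_ge0.
have JB u v : J u -> J v -> J (u - v).
  by move=> Ju Jv a a'; rewrite mulrBr mulrBl; apply/deg_geD/deg_geN.
have JMl a u : J u -> J (a * u) by move=> Ju a1 a'; rewrite mulrA.
have JMr a u : J u -> J (u * a) by move=> Ju a1 a'; rewrite mulrA -mulrA.
have := Gr (Ideal J0 JB JMl JMr) _ 1 1; rewrite mul1r mulr1; apply.
by move=> g Gg a a'; do !apply: deg_geM => //; apply: fG.
Qed.

(** By [truncMl] and [truncMr], the elements all of whose truncations lie in the
    ideal form an ideal; so homogeneity can be tested on generators. *)
Lemma ideal_gen_trunc (G : set R) :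
    (forall g M, G g -> ideal_gen G (trunc M g)) ->
  forall M r, ideal_gen G r -> ideal_gen G (trunc M r).
Proof.
move=> tG M r Gr.
pose J : set R := fun s => forall M, ideal_gen G (trunc M s).
have J0 : J 0 by move=> N; rewrite raddf0; apply: ideal0.
have JB u v : J u -> J v -> J (u - v).
  by move=> Ju Jv N; rewrite raddfB; apply: idealB; [apply: Ju | apply: Jv].
have JMl a u : J u -> J (a * u).
  move=> Ju N; elim: (all_deg_ge a) => [|d h s _ hh _ IH].
    by rewrite mul0r raddf0; apply: ideal0.
  rewrite mulrDl raddfD /= (truncMl _ hh (all_deg_ge u)).
  apply: (@idealD _ (ideal_gen G)); last exact: IH.
  by apply: (@idealMl _ (ideal_gen G)); apply: Ju.
have JMr a u : J u -> J (u * a).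
  move=> Ju N; elim: (all_deg_ge a) => [|d h s _ hh _ IH].
    by rewrite mulr0 raddf0; apply: ideal0.
  rewrite mulrDr raddfD /= (truncMr _ hh (all_deg_ge u)).
  apply: (@idealD _ (ideal_gen G)); last exact: IH.
  by apply: (@Defs.idealMr _ (ideal_gen G)); apply: Ju.
by apply: (Gr (Ideal J0 JB JMl JMr)) => g Gg N; apply: tG.
Qed.

(** The commutator of the truncation of a with h, homogeneous of degree d, is
    the truncation to degrees at most M + d of a * h - h * a, which lives in
    degrees at least N > M + C.  C bounds the degrees of a generating set. *)
Lemma trunc_center C M N a (I : ideal R) :
    (forall z, (forall d h, d <= C -> homog d h -> z * h = h * z) ->
       center R z) ->
    (forall r, I r -> deg_ge N r) -> M + C < N ->
    (forall r, I (a * r - r * a)) ->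
  center R (trunc M a).
Proof.
move=> gen fI MN aI; apply: gen => d h dC hh; apply/eqP; rewrite -subr_eq0.
have -> : trunc M a * h - h * trunc M a = trunc (M + d) (a * h - h * a).
  rewrite raddfB /= (truncMl _ hh (all_deg_ge a)).
  by rewrite (truncMr _ hh (all_deg_ge a)) addrK.
rewrite (trunc_below (fI _ (aI h))) //.
by apply: le_lt_trans MN; rewrite lerD2l.
Qed.
End Bounded.
End Coaction.

(** * Homogeneity of the defining relations *)
Section Degrees.
Variables (D : cartan_datum) (n : nat) (b : wt D).
Implicit Types nu : seqs_of n b.

Definition x_deg (k : 'I_n) nu : int := root_form (color nu k) (color nu k).
Definition t_deg (k : 'I_n.-1) nu : int :=
  - root_form (color nu (pos k)) (color nu (pos1 k)).

Lemma root_formC (i j : idx D) : root_form i j = root_form j i.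
Proof. exact: (@symd_sym D). Qed.

Lemma color_move k nu l :
  color (perm_seqs (stransp k) nu) l = color nu (stransp k l).
Proof. by rewrite /color tnth_mktuple /stransp tpermV. Qed.
End Degrees.

(** The defining relations are compared along two morphisms: proj to a ring
    where they hold, and phi, which multiplies the part of degree d by t d.  A
    generator tau_k of the free algebra F has no degree of its own, since its
    degree depends on the idempotent on its right; so degrees are attached to
    words together with an idempotent. *)
Section HomogeneousWords.
Variables (D : cartan_datum) (K : fieldType) (Q : klr_datum D K).
Variables (n : nat) (b : wt D).
Variables (F : lalgType K) (fe : seqs_of n b -> F) (fx : 'I_n -> F).
Variables (ft : 'I_n.-1 -> F).
Variables (R S : pzRingType) (proj : {rmorphism F -> R}).
Variables (phi : {rmorphism F -> S}) (iota : {rmorphism R -> S}) (t : int -> S).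

Local Notation move k nu := (perm_seqs (stransp k) nu).
Local Notation e nu := (proj (fe nu)).
Local Notation x k := (proj (fx k)).
Local Notation tau k := (proj (ft k)).
Implicit Types (nu mu : seqs_of n b) (d : int) (f g : F).

Hypothesis t0 : t 0 = 1.
Hypothesis tD : forall c d, t (c + d) = t c * t d.
Hypothesis tC : forall d r, t d * iota r = iota r * t d.

Hypothesis sum_e : \sum_nu e nu = 1.
Hypothesis ee : forall nu mu, e nu * e mu = if nu == mu then e nu else 0.
Hypothesis xe : forall k nu, x k * e nu = e nu * x k.
Hypothesis te : forall k nu, tau k * e nu = e (move k nu) * tau k.

Hypothesis phi_scalar : forall c, phi c%:A = iota (proj c%:A).
Hypothesis phi_e : forall nu, phi (fe nu) = iota (e nu).
Hypothesis phi_x :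
  forall k, phi (fx k) = \sum_nu iota (x k * e nu) * t (x_deg k nu).
Hypothesis phi_t :
  forall k, phi (ft k) = \sum_nu iota (tau k * e nu) * t (t_deg k nu).

Definition homog_at d nu f := phi f * iota (e nu) = iota (proj f * e nu) * t d.

Lemma homog_at1 nu : homog_at 0 nu 1.
Proof. by rewrite /homog_at !rmorph1 !mul1r t0 mulr1. Qed.

Lemma homog_at0 d nu : homog_at d nu 0.
Proof. by rewrite /homog_at !raddf0 !mul0r raddf0 mul0r. Qed.

Lemma homog_atD d nu f g :
  homog_at d nu f -> homog_at d nu g -> homog_at d nu (f + g).
Proof.
by rewrite /homog_at => hf hg; rewrite !raddfD /= !mulrDl hf hg raddfD mulrDl.
Qed.

Lemma homog_atN d nu f : homog_at d nu f -> homog_at d nu (- f).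
Proof.
by rewrite /homog_at => hf; rewrite !raddfN /= !mulNr hf raddfN mulNr.
Qed.

Lemma homog_at_sum d nu (I : Type) (s : seq I) (P : pred I) (f : I -> F) :
  (forall i, P i -> homog_at d nu (f i)) ->
  homog_at d nu (\sum_(i <- s | P i) f i).
Proof.
move=> hf; apply: (big_ind (homog_at d nu)); last exact: hf.
  exact: homog_at0.
exact: homog_atD.
Qed.

Lemma homog_atZ c d nu f : homog_at d nu f -> homog_at d nu (c *: f).
Proof.
rewrite /homog_at -mulr_algl (rmorphM phi) (rmorphM proj) /= phi_scalar => hf.
by rewrite -mulrA hf mulrA -(rmorphM iota) mulrA.
Qed.

Lemma homog_at_comp d d' nu mu f g :
    phi f * iota (e nu) = iota (proj f * e nu) * t d ->
    e mu * (proj f * e nu) = proj f * e nu ->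
  homog_at d' mu g -> homog_at (d' + d) nu (g * f).
Proof.
rewrite /homog_at => hf ef hg.
rewrite (rmorphM phi) (rmorphM proj) /= -mulrA hf -ef rmorphM.
rewrite -mulrA mulrA hg -mulrA [t _ * _]mulrA tC -!mulrA -tD.
by rewrite mulrA -(rmorphM iota) -!mulrA ef.
Qed.

Lemma phi_gen_e r (d : seqs_of n b -> int) nu :
  (\sum_mu iota (r * e mu) * t (d mu)) * iota (e nu) =
    iota (r * e nu) * t (d nu).
Proof.
rewrite mulr_suml (bigD1 nu) //= big1 ?addr0 => [|mu /negbTE mu_nu].
  by rewrite -mulrA tC mulrA -rmorphM -mulrA ee eqxx.
by rewrite -mulrA tC mulrA -rmorphM -mulrA ee mu_nu mulr0 raddf0 mul0r.
Qed.

Lemma homog_atMx d nu g k :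
  homog_at d nu g -> homog_at (d + x_deg k nu) nu (g * fx k).
Proof.
apply: homog_at_comp; first by rewrite phi_x phi_gen_e.
by rewrite mulrA -xe -mulrA ee eqxx.
Qed.

Lemma homog_atMt d nu g k :
  homog_at d (move k nu) g -> homog_at (d + t_deg k nu) nu (g * ft k).
Proof.
apply: homog_at_comp; first by rewrite phi_t phi_gen_e.
by rewrite te mulrA ee eqxx.
Qed.

Lemma homog_atMe d nu g mu : homog_at d nu g -> homog_at d nu (g * fe mu).
Proof.
move=> hg; rewrite /homog_at (rmorphM phi) (rmorphM proj) /= phi_e.
rewrite -[in LHS]mulrA -(rmorphM iota) -[in RHS]mulrA ee.
by case: eqP => [->|_] //; rewrite raddf0 !mulr0 raddf0 mul0r.
Qed.

Lemma homog_atMX d nu g k m :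
  homog_at d nu g -> homog_at (d + m%:Z * x_deg k nu) nu (g * fx k ^+ m).
Proof.
move=> hg; elim: m => [|m IHm]; first by rewrite mul0r addr0 mulr1.
rewrite exprSr mulrA intS mulrDl mul1r [x_deg _ _ + _]addrC addrA.
exact: homog_atMx.
Qed.

Lemma homog_at_x nu k : homog_at (x_deg k nu) nu (fx k).
Proof.
by rewrite -[fx k]mul1r -[x_deg _ _]add0r; apply/homog_atMx/homog_at1.
Qed.

Lemma homog_at_t nu k : homog_at (t_deg k nu) nu (ft k).
Proof.
by rewrite -[ft k]mul1r -[t_deg _ _]add0r; apply/homog_atMt/homog_at1.
Qed.

Lemma homog_at_X nu k m : homog_at (m%:Z * x_deg k nu) nu (fx k ^+ m).
Proof.
by rewrite -[_ ^+ _]mul1r -[_ * x_deg _ _]add0r; apply/homog_atMX/homog_at1.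
Qed.

Lemma homog_at_e nu mu : homog_at 0 nu (fe mu).
Proof. by rewrite -[fe mu]mul1r; apply/homog_atMe/homog_at1. Qed.

(** The homogeneity of Q says that each of its monomials has the degree of the
    square of tau. *)
Lemma homog_at_eval2 nu k l i j : i != j -> color nu k = i -> color nu l = j ->
  homog_at (- 2 * root_form i j) nu (eval2 (Q i j) (fx k) (fx l)).
Proof.
move=> ij ki lj; apply: homog_at_sum => q _; apply: homog_at_sum => p _.
have [->|c0] := eqVneq ((Q i j)`_q`_p) 0.
  by rewrite scale0r; apply: homog_at0.
apply: homog_atZ; rewrite -(Qpoly_homog ij c0) ![root_form _ _ * _]mulrC.
have <- : x_deg k nu = root_form i i by rewrite /x_deg ki.
have <- : x_deg l nu = root_form j j by rewrite /x_deg lj.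
exact/homog_atMX/homog_at_X.
Qed.

(** Dividing by u - w lowers the degree of each monomial of Q by the degree
    of one variable x of color i. *)
Lemma homog_at_divdiff nu k l m i j : i != j ->
  color nu k = i -> color nu l = j -> color nu m = i ->
  homog_at (- 2 * root_form i j - root_form i i) nu
    (divdiff (Q i j) (fx k) (fx l) (fx m)).
Proof.
move=> ij ki lj mi; apply: homog_at_sum => q _; apply: homog_at_sum => p _.
have [->|c0] := eqVneq ((Q i j)`_q`_p) 0.
  by rewrite scale0r; apply: homog_at0.
apply: homog_atZ; rewrite mulr_suml; apply: homog_at_sum => r _.
rewrite -(Qpoly_homog ij c0).
have -> : root_form i i * p%:Z + root_form j j * q%:Z - root_form i i =
    (p.-1 - r)%:Z * x_deg k nu + r%:Z * x_deg m nu + q%:Z * x_deg l nu.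
  rewrite /x_deg ki lj mi.
  have -> : p%:Z = (p.-1 - r)%:Z + r%:Z + 1 by case: r => r /=; lia.
  by ring.
by apply/homog_atMX/homog_atMX/homog_at_X.
Qed.

(** The unit is the sum of the e(nu), and on each e(nu) the values phi f and
    phi g are determined by proj f = proj g and by the common degree. *)
Lemma phi_eq f g : proj f = proj g ->
  (forall nu, exists d, homog_at d nu f /\ homog_at d nu g) -> phi f = phi g.
Proof.
move=> fg h; rewrite -[phi f]mulr1 -[phi g]mulr1 -(rmorph1 iota) -sum_e.
rewrite rmorph_sum !mulr_sumr; apply: eq_bigr => nu _.
by have [d [hf hg]] := h nu; rewrite hf hg fg.
Qed.

Lemma phi_eq_e f g nu : proj (f * fe nu) = proj (g * fe nu) ->
  (exists d, homog_at d nu f /\ homog_at d nu g) ->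
  phi (f * fe nu) = phi (g * fe nu).
Proof.
rewrite (rmorphM phi) (rmorphM proj) (rmorphM phi) (rmorphM proj) /= phi_e.
by move=> fg [d [hf hg]]; rewrite hf hg fg.
Qed.
End HomogeneousWords.

Section RelationsHomogeneous.
Variables (D : cartan_datum) (K : fieldType) (Q : klr_datum D K).
Variables (n : nat) (b : wt D).
Local Notation F := (klr_free K n b).
Variables (R S : pzRingType) (proj : {rmorphism F -> R}).
Variables (phi : {rmorphism F -> S}) (iota : {rmorphism R -> S}) (t : int -> S).
Local Notation move k nu := (perm_seqs (stransp k) nu).
Local Notation e nu := (proj (fe K nu)).
Local Notation x k := (proj (fx K b k)).
Local Notation tau k := (proj (ft K b k)).

Hypothesis t0 : t 0 = 1.
Hypothesis tD : forall c d, t (c + d) = t c * t d.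
Hypothesis tC : forall d r, t d * iota r = iota r * t d.
Hypothesis proj_rel : forall f g, klr_rel Q f g -> proj f = proj g.
Hypothesis phi_scalar : forall c, phi c%:A = iota (proj c%:A).
Hypothesis phi_e : forall nu, phi (fe K nu) = iota (e nu).
Hypothesis phi_x :
  forall k, phi (fx K b k) = \sum_nu iota (x k * e nu) * t (x_deg k nu).
Hypothesis phi_t :
  forall k, phi (ft K b k) = \sum_nu iota (tau k * e nu) * t (t_deg k nu).

Lemma proj_sum_e : \sum_(nu : seqs_of n b) e nu = 1.
Proof.
rewrite -(rmorph1 proj) -(proj_rel (rel_sum_e Q n b)).
by rewrite (raddf_sum proj).
Qed.

Lemma proj_ee (nu mu : seqs_of n b) :
  e nu * e mu = if nu == mu then e nu else 0.
Proof.
rewrite -(rmorphM proj (fe K nu) (fe K mu)) (proj_rel (rel_ee Q nu mu)).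
by case: eqP => // _; apply: raddf0.
Qed.

Lemma proj_xe k (nu : seqs_of n b) : x k * e nu = e nu * x k.
Proof.
rewrite -(rmorphM proj (fx K b k) (fe K nu)) (proj_rel (rel_xe Q k nu)).
exact: (rmorphM proj (fe K nu) (fx K b k)).
Qed.

Lemma proj_te k (nu : seqs_of n b) : tau k * e nu = e (move k nu) * tau k.
Proof.
rewrite -(rmorphM proj (ft K b k) (fe K nu)) (proj_rel (rel_te Q k nu)).
exact: (rmorphM proj (fe K (move k nu)) (ft K b k)).
Qed.

Lemma pos_succ (k k1 : 'I_n.-1) : k1 = k.+1 :> nat -> pos k1 = pos1 k.
Proof. by move=> kk; apply: val_inj. Qed.

Lemma eval2_0 (A : lalgType K) (u v : A) : eval2 0 u v = 0.
Proof. by rewrite /eval2 size_poly0 big_ord0. Qed.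

Lemma divdiff_0 (A : lalgType K) (u v w : A) : divdiff 0 u v w = 0.
Proof. by rewrite /divdiff size_poly0 big_ord0. Qed.

(** Each relation equates two combinations of words that have one common degree
    at every idempotent. *)
Lemma coact_rel f g : klr_rel Q f g -> phi f = phi g.
Proof.
pose wh := @homog_at D K n b F (fe K (b := b)) R S proj phi iota t.
(* Collecting the closure properties and then forgetting the definition of
   wh keeps the case analysis purely about degrees. *)
have h0 d nu : wh d nu 0 by apply: homog_at0.
have h1 nu : wh 0 nu 1 by apply: homog_at1.
have hN d nu h : wh d nu h -> wh d nu (- h) by apply: homog_atN.
have hD d nu h h' : wh d nu h -> wh d nu h' -> wh d nu (h + h').
  exact: homog_atD.
have hx d nu h k : wh d nu h -> wh (d + x_deg k nu) nu (h * fx K b k).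
  by apply: homog_atMx => //; [exact: proj_ee | exact: proj_xe].
have ht d nu h k : wh d (move k nu) h -> wh (d + t_deg k nu) nu (h * ft K b k).
  by apply: homog_atMt => //; [exact: proj_ee | exact: proj_te].
have he nu mu : wh 0 nu (fe K mu).
  by apply: homog_at_e => //; exact: proj_ee.
have hx1 nu k : wh (x_deg k nu) nu (fx K b k).
  apply: (homog_at_x (fx := fx K b)) => //; first exact: proj_ee.
  exact: proj_xe.
have ht1 nu k : wh (t_deg k nu) nu (ft K b k).
  apply: (homog_at_t (ft := ft K b)) => //; first exact: proj_ee.
  exact: proj_te.
have eqP0 h h' : klr_rel Q h h' ->
    (forall nu, exists d, wh d nu h /\ wh d nu h') ->
    phi h = phi h'.
  by move=> /proj_rel; apply: phi_eq => //; exact: proj_sum_e.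
have eqP1 h h' nu : klr_rel Q (h * fe K nu) (h' * fe K nu) ->
    (exists d, wh d nu h /\ wh d nu h') ->
    phi (h * fe K nu) = phi (h' * fe K nu).
  by move=> /proj_rel; apply: phi_eq_e.
have hMe d nu h mu : wh d nu h -> wh d nu (h * fe K mu).
  by apply: homog_atMe => //; exact: proj_ee.
have hev nu k l i j : i != j -> color nu k = i -> color nu l = j ->
    wh (- 2 * root_form i j) nu (eval2 (Q i j) (fx K b k) (fx K b l)).
  by apply: homog_at_eval2 => //; [exact: proj_ee | exact: proj_xe].
have hdd nu k l m i j : i != j ->
    color nu k = i -> color nu l = j -> color nu m = i ->
    wh (- 2 * root_form i j - root_form i i) nu
      (divdiff (Q i j) (fx K b k) (fx K b l) (fx K b m)).
  by apply: homog_at_divdiff => //; [exact: proj_ee | exact: proj_xe].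
clearbody wh => fg.
case: (fg) => [nu mu||k l|k nu|l nu|k l kl|k nu|k l nu|k k1 nu kk1].
- apply: eqP0 => [|ka]; first exact: rel_ee.
  by exists 0; split; [apply/hMe/he | case: ifP].
- rewrite (raddf_sum phi) rmorph1 -(rmorph1 iota) -proj_sum_e (raddf_sum iota).
  by apply: eq_bigr => nu _; apply: phi_e.
- apply: eqP0 => [|ka]; first exact: rel_xx.
  exists (x_deg k ka + x_deg l ka); split; first exact/hx/hx1.
  by rewrite addrC; apply/hx/hx1.
- apply: eqP0 => [|ka]; first exact: rel_xe.
  exists (x_deg k ka); split; first exact/hMe/hx1.
  by rewrite -[x_deg k ka]add0r; apply/hx/he.
- apply: eqP0 => [|ka]; first exact: rel_te.
  exists (t_deg l ka); split; first exact/hMe/ht1.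
  by rewrite -[t_deg l ka]add0r; apply/ht/he.
- apply: eqP0 => [|ka]; first exact: rel_tt.
  exists (t_deg k (move l ka) + t_deg l ka); split; first exact/ht/ht1.
  have far (a c : 'I_n.-1) : (a.+1 < c)%N || (c.+1 < a)%N ->
      t_deg c (move a ka) = t_deg c ka.
    move=> ac; rewrite /t_deg !color_move /stransp !tpermD //;
    by rewrite -val_eqE /=; apply/eqP; lia.
  rewrite far; last by rewrite orbC.
  by rewrite addrC -{1}(far _ _ kl); apply/ht/ht1.
- (* the square of tau: both sides have degree -2 (i, j) if the colors differ,
     and Q is zero if they agree *)
  apply: eqP1; first exact: rel_t2.
  exists (t_deg k (move k nu) + t_deg k nu); split; first exact/ht/ht1.
  case: (eqVneq (color nu (pos k)) (color nu (pos1 k))) => [->|ij].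
    by rewrite Qpoly_diag eval2_0.
  rewrite [X in wh X](_ : _ =
      - 2 * root_form (color nu (pos k)) (color nu (pos1 k))).
    exact: hev.
  rewrite /t_deg !color_move /stransp tpermL tpermR.
  by rewrite [root_form (color nu (pos1 k)) _]root_formC; ring.
- (* the correction term is a sign times e(nu), and for equal colors tau_k x_k
     has degree -(i, i) + (i, i) = 0 *)
  set c := color nu (pos k) == color nu (pos1 k).
  pose g0 : F :=
    if c then if l == pos k then -1 else if l == pos1 k then 1 else 0 else 0.
  have g0E : (if c then if l == pos k then - fe K nu
      else if l == pos1 k then fe K nu else 0 else 0) = g0 * fe K nu.
    by rewrite /g0; do !case: ifP => _; rewrite ?mulN1r ?mul1r ?mul0r.
  rewrite g0E; apply: eqP1; first by rewrite -g0E; apply: rel_tx.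
  exists (t_deg k nu + x_deg l nu); split.
    apply: hD; first exact: hx.
    apply: hN; rewrite addrC.
    have -> : x_deg l nu = x_deg (stransp k l) (move k nu).
      by rewrite /x_deg color_move /stransp tpermK.
    exact/ht/hx1.
  rewrite /g0; case: ifP => [/eqP kk|_]; last exact: h0.
  have d0 : l = pos k \/ l = pos1 k -> t_deg k nu + x_deg l nu = 0.
    by rewrite /t_deg /x_deg kk => -[] ->; rewrite ?kk addNr.
  case: eqP => [lk|_]; first by rewrite d0 ?lk; [apply/hN/h1 | left].
  case: eqP => [lk|_]; last exact: h0.
  by rewrite d0 ?lk; [apply: h1 | right].
- (* for colors u, v, w both triple products cross each pair of strands once,
     hence have degree -(u, v) - (u, w) - (v, w) *)
  set c := color nu (pos k) == color nu (pos1 k1).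
  pose g0 : F := if c then
    divdiff (Q (color nu (pos k)) (color nu (pos k1)))
      (fx K b (pos k)) (fx K b (pos k1)) (fx K b (pos1 k1)) else 0.
  have g0E : (if c then
    divdiff (Q (color nu (pos k)) (color nu (pos k1)))
      (fx K b (pos k)) (fx K b (pos k1)) (fx K b (pos1 k1)) * fe K nu else 0)
      = g0 * fe K nu.
    by rewrite /g0; case: ifP => _; rewrite ?mul0r.
  rewrite g0E; apply: eqP1; first by rewrite -g0E; apply: rel_braid.
  pose u := color nu (pos k); pose v := color nu (pos k1).
  pose w := color nu (pos1 k1).
  have kk1' := pos_succ kk1.
  have [ne1 ne2] : pos k != pos k1 /\ pos k != pos1 k1.
    by split; rewrite -val_eqE /=; apply/eqP; lia.
  have ne3 : pos k1 != pos1 k1 by rewrite -val_eqE /=; apply/eqP; lia.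
  have s1 : stransp k1 (pos k) = pos k by rewrite /stransp tpermD // eq_sym.
  have s2 : stransp k (pos1 k1) = pos1 k1.
    by rewrite /stransp tpermD // -kk1'.
  have s3 : stransp k (pos k) = pos k1 by rewrite /stransp tpermL kk1'.
  have s4 : stransp k (pos k1) = pos k by rewrite /stransp -kk1' tpermR.
  have s5 : stransp k1 (pos k1) = pos1 k1 by rewrite /stransp tpermL.
  have s6 : stransp k1 (pos1 k1) = pos k1 by rewrite /stransp tpermR.
  have colE := (color_move, s1, s2, s3, s4, s5, s6).
  exists (- root_form u v - root_form u w - root_form v w); split.
    apply: hD.
      have -> : - root_form u v - root_form u w - root_form v w =
          t_deg k1 (move k (move k1 nu)) + t_deg k (move k1 nu) + t_deg k1 nu.
        by rewrite /t_deg -kk1' !colE -/u -/v -/w.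
      exact/ht/ht/ht1.
    apply: hN.
    have -> : - root_form u v - root_form u w - root_form v w =
        t_deg k (move k1 (move k nu)) + t_deg k1 (move k nu) + t_deg k nu.
      by rewrite /t_deg -kk1' !colE -/u -/v -/w; ring.
    exact/ht/ht/ht1.
  rewrite /g0; case: ifP => [/eqP uw|_]; last exact: h0.
  case: (eqVneq (color nu (pos k)) (color nu (pos k1))) => [->|ij].
    by rewrite Qpoly_diag divdiff_0.
  rewrite [X in wh X](_ : _ = - 2 * root_form u v - root_form u u).
    exact: hdd.
  by rewrite /w -uw -/u [root_form v u]root_formC; ring.
Qed.
End RelationsHomogeneous.

(** * The grading of the KLR algebra *)
Section CoactionExists.
Variables (D : cartan_datum) (K : fieldType) (Q : klr_datum D K).
Variables (n : nat) (b : wt D).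
Local Notation F := (klr_free K n b).
Variables (R : pzRingType) (proj : {rmorphism F -> R}).
Hypothesis proj_rel : forall f g, klr_rel Q f g -> proj f = proj g.
Hypothesis proj_scalarC : forall c, center R (proj c%:MP).
Local Notation S := (endo (int -> R)).
Local Notation e nu := (proj (fe K nu)).
Local Notation x k := (proj (fx K b k)).
Local Notation tau k := (proj (ft K b k)).

Definition coact_scalar : {rmorphism K -> S} :=
  @lmul R \o (proj \o @malgC {fmonom klr_gen n b} K).

Definition coact_gen (a : klr_gen n b) : S :=
  match a with
  | inl (inl nu) => lmul (e nu)
  | inl (inr k) => \sum_nu lmul (x k * e nu) * shift R (x_deg k nu)
  | inr k => \sum_nu lmul (tau k * e nu) * shift R (t_deg k nu)
  end.

Lemma coact_scalarC c (a : klr_gen n b) :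
  GRing.comm (coact_scalar c) (coact_gen a).
Proof.
have cC r d : GRing.comm (coact_scalar c) (lmul r * shift R d).
  rewrite /GRing.comm mulrA -(rmorphM (@lmul R) _ r) -mulrA shift_lmul mulrA.
  by rewrite -(rmorphM (@lmul R) r) proj_scalarC.
case: a => [[nu|k]|k] /=; [|by apply: commr_sum => nu _; apply: cC..].
by have := cC (e nu) 0; rewrite shift0 mulr1.
Qed.

Definition coact_free : F -> S := free_lift coact_scalar coact_gen.

HB.instance Definition _ := GRing.isZmodMorphism.Build F S coact_free
  (@free_lift_zmod K _ S coact_scalar coact_gen).
HB.instance Definition _ := GRing.isMonoidMorphism.Build F S coact_free
  (free_lift_monoid coact_scalarC).

Definition coact_rmorphism : {rmorphism F -> S} := coact_free.

Lemma coact_free_rel f g :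
  klr_rel Q f g -> coact_rmorphism f = coact_rmorphism g.
Proof.
apply: (coact_rel (shift0 R) (@shiftD R) (@shift_lmul R) proj_rel)
  => [c|nu|k|k].
- rewrite -[c%:A]mul_malgC mulr1; exact: free_liftC.
- exact: free_lift_gen.
- exact: free_lift_gen.
- exact: free_lift_gen.
Qed.

Section HomogeneousGenerators.
Variable delta : {rmorphism R -> S}.
Hypothesis deltaE : forall f, delta (proj f) = coact_free f.

Lemma homog_scalar c : homog delta 0 (proj c%:MP).
Proof. by rewrite /homog deltaE shift0 mulr1; apply: free_liftC. Qed.

Lemma homog_e nu : homog delta 0 (e nu).
Proof. by rewrite /homog deltaE shift0 mulr1; apply: free_lift_gen. Qed.

Lemma homog_xe k nu : homog delta (x_deg k nu) (x k * e nu).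
Proof.
rewrite /homog rmorphM (deltaE (fx K b k)).
have -> : delta (e nu) = lmul (e nu) by rewrite deltaE; apply: free_lift_gen.
rewrite [coact_free _]free_lift_gen.
by apply: (phi_gen_e (shift_lmul (R := R)) (proj_ee proj_rel)).
Qed.

Lemma homog_te k nu : homog delta (t_deg k nu) (tau k * e nu).
Proof.
rewrite /homog rmorphM (deltaE (ft K b k)).
have -> : delta (e nu) = lmul (e nu) by rewrite deltaE; apply: free_lift_gen.
rewrite [coact_free _]free_lift_gen.
by apply: (phi_gen_e (shift_lmul (R := R)) (proj_ee proj_rel)).
Qed.
End HomogeneousGenerators.
End CoactionExists.

Section KLRCoaction.
Variables (D : cartan_datum) (K : fieldType) (Q : klr_datum D K).
Variables (n : nat) (b : wt D).
Local Notation F := (klr_free K n b).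
Local Notation R := (KLR Q n b).
Local Notation proj := (@klr_proj D K Q n b).

Definition klr_coact_free : {rmorphism F -> endo (int -> R)} :=
  coact_rmorphism (proj := proj) (@klr_scalar_center D K Q n b).

Lemma klr_coact_ker f : klr_ideal Q n b f -> klr_coact_free f = 0.
Proof.
apply: ideal_gen_ker => _ [g [h [gh ->]]]; rewrite (raddfB klr_coact_free).
apply/eqP; rewrite subr_eq0; apply/eqP.
exact: (coact_free_rel (@klr_relP D K Q n b) (@klr_scalar_center D K Q n b) gh).
Qed.

Definition klr_coact : {rmorphism R -> endo (int -> R)} :=
  quot_lift_morph klr_coact_ker.

Lemma klr_coactE f : klr_coact (proj f) = klr_coact_free f.
Proof. exact: (quot_liftE klr_coact_ker). Qed.

End KLRCoaction.

(** * Rings spanned by descending products *)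
Section Spanning.
Variables (R : pzRingType) (base : R -> Prop) (tau : nat -> R).
Implicit Types (r s a g y : R) (i j k q : nat).

Inductive subring_upto q : R -> Prop :=
| upto1 : subring_upto q 1
| upto_base g of base g : subring_upto q g
| upto_tau k of (k < q)%N : subring_upto q (tau k)
| uptoN r of subring_upto q r : subring_upto q (- r)
| uptoD r s of subring_upto q r & subring_upto q s : subring_upto q (r + s)
| uptoM r s of subring_upto q r & subring_upto q s : subring_upto q (r * s).

(* The relations of a nil Hecke ring, up to errors in the subring generated by
   base. *)
Hypothesis tau_base : forall k g, base g ->
  exists g' y, [/\ base g', subring_upto 0 y & tau k * g = g' * tau k + y].
Hypothesis tau_far : forall k l, (k.+1 < l)%N -> GRing.comm (tau k) (tau l).
Hypothesis tau_sqr : forall k, subring_upto 0 (tau k * tau k).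
Hypothesis tau_braid : forall k,
  subring_upto 0 (tau k.+1 * tau k * tau k.+1 - tau k * tau k.+1 * tau k).

Lemma upto0 q : subring_upto q 0.
Proof. by rewrite -(subrr 1); apply: uptoD (uptoN _); apply: upto1. Qed.

Definition desc_prod j l : R := \prod_(i <- rev (index_iota j l)) tau i.

Lemma desc_geq j l : (l <= j)%N -> desc_prod j l = 1.
Proof. by move=> lj; rewrite /desc_prod /index_iota (eqP lj) big_nil. Qed.

Lemma desc_recr j l : (j < l)%N -> desc_prod j l = desc_prod j.+1 l * tau j.
Proof.
by move=> jl; rewrite /desc_prod /index_iota -(subnSK jl) /= rev_cons
   -cats1 big_cat big_seq1.
Qed.

Lemma desc_cat j i l :
  (j <= i <= l)%N -> desc_prod j l = desc_prod i l * desc_prod j i.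
Proof.
case/andP=> ji il; rewrite /desc_prod -big_cat -rev_cat /index_iota /=.
by rewrite -{2}(subnKC ji) -iotaD addnC addnBA // subnK.
Qed.

Lemma desc_comm k j l : (k.+1 < j)%N -> GRing.comm (desc_prod j l) (tau k).
Proof.
move=> kj; apply: commr_sym; rewrite /desc_prod big_seq; apply: commr_prod => i.
rewrite mem_rev mem_index_iota => /andP[ji _].
by apply: tau_far; apply: leq_trans ji.
Qed.

Section Step.
Variable q : nat.
Local Notation D j := (desc_prod j q.+1).

(** Filtration of the span in [upto_desc_span] by how far down the descending
    products may reach.  Right multiplication by tau_k with k < j leaves the
    step j stable, except that k = j - 1 leads to the step j - 1. *)
Inductive desc_span j : R -> Prop :=
| desc_span0 : desc_span j 0
| desc_span_cons a i r of (j <= i <= q.+1)%N & subring_upto q a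
    & desc_span j r : desc_span j (a * D i + r).

Lemma desc_span_desc a j i :
  (j <= i <= q.+1)%N -> subring_upto q a -> desc_span j (a * D i).
Proof.
by move=> ji sa; rewrite -[_ * _]addr0; apply: desc_span_cons (desc_span0 j).
Qed.

Lemma desc_span_D j r s : desc_span j r -> desc_span j s -> desc_span j (r + s).
Proof.
move=> sr ss; elim: sr => [|a i u ji sa _ IH]; first by rewrite add0r.
by rewrite -addrA; apply: desc_span_cons.
Qed.

Lemma desc_span_Ml j a r :
  subring_upto q a -> desc_span j r -> desc_span j (a * r).
Proof.
move=> sa; elim=> [|a' i u ji sa' _ IH].
  by rewrite mulr0; apply: desc_span0.
by rewrite mulrDr mulrA; apply: desc_span_cons => //; apply: uptoM.
Qed.

Lemma desc_span_N j r : desc_span j r -> desc_span j (- r).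
Proof. by rewrite -mulN1r; apply/desc_span_Ml/uptoN/upto1. Qed.

Lemma desc_span_le i j r : (i <= j)%N -> desc_span j r -> desc_span i r.
Proof.
move=> ij; elim=> [|a i' u /andP[ji iq] sa _ IH]; first exact: desc_span0.
by apply: desc_span_cons => //; rewrite (leq_trans ij ji).
Qed.

Lemma desc_span_Mr j j' s :
    (forall i, (j <= i <= q.+1)%N -> desc_span j' (D i * s)) ->
  forall r, desc_span j r -> desc_span j' (r * s).
Proof.
move=> Ds r; elim=> [|a i u ji sa _ IH].
  by rewrite mul0r; apply: desc_span0.
rewrite mulrDl -mulrA; apply: desc_span_D => //.
by apply: desc_span_Ml => //; apply: Ds.
Qed.

Lemma desc_span_tau_far j k r :
  (k.+1 < j)%N -> desc_span j r -> desc_span j (r * tau k).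
Proof.
move=> kj; apply: desc_span_Mr => i /andP[ji iq].
rewrite desc_comm ?(leq_trans kj) //.
apply: desc_span_desc; first by rewrite ji.
by apply: upto_tau; rewrite -ltnS (leq_trans _ iq) // (leq_trans kj).
Qed.

Lemma desc_span_tau_pred k r : desc_span k.+1 r -> desc_span k (r * tau k).
Proof.
apply: desc_span_Mr => i /andP[]; rewrite leq_eqVlt => /orP[/eqP <-|ki] iq.
  rewrite -desc_recr // -[D k]mul1r; apply: desc_span_desc; last exact: upto1.
  by rewrite leqnn ltnW.
apply: (desc_span_le (leqnSn k)); apply: (desc_span_le (ltnW ki)).
apply: desc_span_tau_far => //; rewrite -[D i]mul1r.
by apply: desc_span_desc (upto1 q); rewrite leqnn.
Qed.

Lemma desc_span_Mbase_sub j :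
    (forall g r, base g -> desc_span j r -> desc_span j (r * g)) ->
  forall y r, subring_upto 0 y -> desc_span j r -> desc_span j (r * y).
Proof.
move=> sb y r sy.
elim: sy r => [|g bg|//|u _ IH|u v _ IHu _ IHv|u v _ IHu _ IHv] r sr.
- by rewrite mulr1.
- exact: sb.
- by rewrite mulrN; apply/desc_span_N/IH.
- by rewrite mulrDr; apply: desc_span_D; [apply: IHu | apply: IHv].
- by rewrite mulrA; apply/IHv/IHu.
Qed.

(** Downward induction on j.  Moving g through the last factor tau_j of D j
    leaves either D (j + 1) * g' * tau_j or an error D (j + 1) * y, and both are
    controlled by the statement for j + 1. *)
Lemma desc_span_base j g r : base g -> desc_span j r -> desc_span j (r * g).
Proof.
have [m] := ubnP (q.+2 - j); elim: m j g r => // m IHm j g r jm bg.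
apply: desc_span_Mr => i /andP[ji iq]; apply: (desc_span_le ji).
move: iq; rewrite leq_eqVlt => /orP[/eqP iq|iq].
  rewrite {2}iq desc_geq // mul1r -[g]mulr1 -(desc_geq (leqnn q.+1)).
  by apply: desc_span_desc; [rewrite iq leqnn | apply: upto_base].
have [g' [y [bg' sy tg]]] := tau_base i bg.
have IH g1 u : base g1 -> desc_span i.+1 u -> desc_span i.+1 (u * g1).
  by apply: IHm; lia.
have Di : desc_span i.+1 (D i.+1).
  by rewrite -[D _]mul1r; apply: desc_span_desc (upto1 q); rewrite leqnn.
rewrite desc_recr // -mulrA tg mulrDr mulrA; apply: desc_span_D.
  by apply: desc_span_tau_pred; apply: IH.
by apply: (desc_span_le (leqnSn i)); apply: desc_span_Mbase_sub.
Qed.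

Lemma desc_span_sub0 j y r :
  subring_upto 0 y -> desc_span j r -> desc_span j (r * y).
Proof. by apply: desc_span_Mbase_sub => *; apply: desc_span_base. Qed.

Lemma desc_span_desc_far i j r :
  desc_span i.+1 r -> desc_span i.+1 (r * desc_prod j i).
Proof.
rewrite /desc_prod; suff: all (fun k => k < i)%N (rev (index_iota j i)).
  elim: rev r => [|k s IHs] r; first by rewrite big_nil mulr1.
  move=> /andP[ki ks] sr; rewrite big_cons mulrA; apply: IHs => //.
  exact: desc_span_tau_far.
by apply/allP => k; rewrite mem_rev mem_index_iota => /andP[].
Qed.

(** The cases of D j * tau_k.  If k < j, then tau_k moves to the left through
    D j or extends it.  If k = j, the square of tau_j appears and is in the base
    subring.  If k > j, the braid relation turns tau_k tau_(k-1) tau_k into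
    tau_(k-1) tau_k tau_(k-1) up to the base subring, and the left tau_(k-1)
    commutes with the remaining factors to its left. *)
Lemma desc_span_tau k r :
  (k <= q)%N -> desc_span 0 r -> desc_span 0 (r * tau k).
Proof.
move=> kq; apply: desc_span_Mr => j /= jq.
have sD i : (i <= q.+1)%N -> desc_span i (D i).
  move=> iq; rewrite -[D i]mul1r.
  by apply: desc_span_desc (upto1 q); rewrite leqnn.
have [kj|jk|<-] := ltngtP k j.
- apply: (desc_span_le (leq0n k)); apply: desc_span_tau_pred.
  by apply: (desc_span_le kj); apply: sD.
- case: k jk kq => // i ji iq; have iq' := ltnW iq.
  have splitD : D j = D i.+2 * tau i.+1 * tau i * desc_prod j i.
    rewrite -(@desc_recr i.+1) ?ltnS // -(@desc_recr i) // -desc_cat //.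
    by rewrite -ltnS ji ltnW.
  have com : desc_prod j i * tau i.+1 = tau i.+1 * desc_prod j i.
    apply: commr_sym; rewrite /desc_prod big_seq; apply: commr_prod => l.
    rewrite mem_rev mem_index_iota => /andP[_ li].
    by apply/commr_sym/tau_far.
  have -> : D j * tau i.+1 = tau i * D j + D i.+2 *
      (tau i.+1 * tau i * tau i.+1 - tau i * tau i.+1 * tau i) * desc_prod j i.
    have com' : tau i * D i.+2 = D i.+2 * tau i by apply/esym/desc_comm.
    by rewrite splitD -[LHS]mulrA com mulrBr mulrBl !mulrA com' addrC subrK.
  apply: desc_span_D.
    by apply: desc_span_desc => //; apply: upto_tau.
  apply: (desc_span_le (leq0n i.+1)); apply: desc_span_desc_far.
  by apply: (desc_span_le (leqnSn _)); apply: desc_span_sub0 => //; apply: sD.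
- rewrite desc_recr // -mulrA; apply: (desc_span_le (leq0n k.+1)).
  by apply: desc_span_sub0 => //; apply: sD.
Qed.

(** The span contains 1 and is stable under right multiplication by
    all the generators. *)
Lemma upto_desc_span r : subring_upto q.+1 r -> desc_span 0 r.
Proof.
suff sM s : subring_upto q.+1 s ->
    forall r, desc_span 0 r -> desc_span 0 (r * s).
  move=> sr; rewrite -[r]mul1r; apply: sM => //.
  rewrite -(desc_geq (leqnn q.+1)) -[D _]mul1r.
  by apply: desc_span_desc (upto1 q); rewrite leqnn.
elim=> {r s} [|g bg|k kq|u _ IH|u v _ IHu _ IHv|u v _ IHu _ IHv] r sr.
- by rewrite mulr1.
- exact: desc_span_base.
- exact: desc_span_tau.
- by rewrite mulrN; apply/desc_span_N/IH.
- by rewrite mulrDr; apply: desc_span_D; [apply: IHu | apply: IHv].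
- by rewrite mulrA; apply/IHv/IHu.
Qed.
End Step.
End Spanning.

(** * The KLR algebra is spanned over its polynomial part *)
Section MorphismExpansions.
Variables (A B : pzRingType) (f : {rmorphism A -> B}).

Lemma morph_commutator a b c d u :
  f ((a * b - c * d) * u) = (f a * f b - f c * f d) * f u.
Proof. by rewrite rmorphM rmorphB !rmorphM. Qed.

Lemma morph_braid a b u :
  f ((a * b * a - b * a * b) * u) = (f a * f b * f a - f b * f a * f b) * f u.
Proof. by rewrite rmorphM rmorphB !rmorphM. Qed.
End MorphismExpansions.

Section KLRSpanning.
Variables (D : cartan_datum) (K : fieldType) (Q : klr_datum D K).
Variables (n : nat) (b : wt D).
Local Notation F := (klr_free K n b).
Variables (R : pzRingType) (proj : {rmorphism F -> R}).
Local Notation move k nu := (perm_seqs (stransp k) nu).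
Local Notation e nu := (proj (fe K nu)).
Local Notation x k := (proj (fx K b k)).
Local Notation tau k := (proj (ft K b k)).

Hypothesis proj_rel : forall f g, klr_rel Q f g -> proj f = proj g.
Hypothesis proj_scalarC : forall c, center R (proj c%:MP).

(** Generators of the polynomial part of the KLR algebra: the sum over nu of the
    polynomials in the x_k times e(nu). *)
Inductive poly_gen : R -> Prop :=
| poly_scalar c : poly_gen (proj c%:MP)
| poly_e nu : poly_gen (e nu)
| poly_x k : poly_gen (x k).

(** Extending the family of the tau's by zero to all natural numbers makes every
    commutation, square and braid relation hold with no bound on the indices. *)
Definition tau_nat (k : nat) : R := oapp (fun i : 'I_n.-1 => tau i) 0 (insub k).

Local Notation poly_part := (subring_upto poly_gen tau_nat 0).

Lemma tau_natE (i : 'I_n.-1) : tau_nat i = tau i.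
Proof. by rewrite /tau_nat valK. Qed.

Variant tau_nat_spec k : R -> Prop :=
| TauNatIn (i : 'I_n.-1) of i = k :> nat : tau_nat_spec k (tau i)
| TauNatOut : tau_nat_spec k 0.

Lemma tau_natP k : tau_nat_spec k (tau_nat k).
Proof. by rewrite /tau_nat; case: insubP => [i _ ik|_]; constructor. Qed.

Lemma poly_part_sum (I : Type) (l : seq I) (P : pred I) (f : I -> R) :
  (forall i, P i -> poly_part (f i)) -> poly_part (\sum_(i <- l | P i) f i).
Proof.
by move=> cf; apply: (big_ind poly_part) => //; [exact: upto0 | exact: uptoD].
Qed.

Lemma poly_part_X r m : poly_part r -> poly_part (r ^+ m).
Proof.
move=> cr; elim: m => [|m IHm]; first exact: upto1.
by rewrite exprS; apply: uptoM.
Qed.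

Lemma poly_part_projZ c f : poly_part (proj f) -> poly_part (proj (c *: f)).
Proof.
move=> cf; rewrite -[c *: f]mul_malgC (rmorphM proj c%:MP f).
by apply: uptoM cf; apply/upto_base/poly_scalar.
Qed.

Lemma poly_part_proj_sum (I : Type) (l : seq I) (P : pred I) (f : I -> F) :
  (forall i, P i -> poly_part (proj (f i))) ->
  poly_part (proj (\sum_(i <- l | P i) f i)).
Proof. by move=> cf; rewrite (raddf_sum proj); apply: poly_part_sum. Qed.

Lemma poly_part_projM f g :
  poly_part (proj f) -> poly_part (proj g) -> poly_part (proj (f * g)).
Proof. by move=> cf cg; rewrite (rmorphM proj f g); apply: uptoM. Qed.

Lemma poly_part_projX k m : poly_part (proj (fx K b k ^+ m)).
Proof. by rewrite (rmorphXn proj); apply/poly_part_X/upto_base/poly_x. Qed.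

Lemma poly_part_eval2 p k l : poly_part (proj (eval2 p (fx K b k) (fx K b l))).
Proof.
do 2!(apply: poly_part_proj_sum => ? _); apply: poly_part_projZ.
by apply: poly_part_projM; apply: poly_part_projX.
Qed.

Lemma poly_part_divdiff p k l m :
  poly_part (proj (divdiff p (fx K b k) (fx K b l) (fx K b m))).
Proof.
do 2!(apply: poly_part_proj_sum => ? _).
apply/poly_part_projZ/poly_part_projM/poly_part_projX.
apply: poly_part_proj_sum => ? _.
by apply: poly_part_projM; apply: poly_part_projX.
Qed.

Lemma mul_sum_e r : r = \sum_nu r * e nu.
Proof. by rewrite -mulr_sumr (proj_sum_e proj_rel) mulr1. Qed.

Lemma poly_part_of_e r : (forall nu, poly_part (r * e nu)) -> poly_part r.
Proof.
rewrite [X in _ -> poly_part X]mul_sum_e => cr.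
by apply: poly_part_sum => *; apply: cr.
Qed.

Lemma proj_tt (k l : 'I_n.-1) : (k.+1 < l)%N -> tau k * tau l = tau l * tau k.
Proof.
move=> kl; have kl' : (k.+1 < l)%N || (l.+1 < k)%N by rewrite kl.
rewrite -(rmorphM proj (ft K b k) (ft K b l)) (proj_rel (rel_tt Q b kl')).
exact: (rmorphM proj (ft K b l) (ft K b k)).
Qed.

Lemma proj_t2 k (nu : seqs_of n b) : tau k * tau k * e nu =
  proj (eval2 (Q (color nu (pos k)) (color nu (pos1 k)))
         (fx K b (pos k)) (fx K b (pos1 k)) * fe K nu).
Proof.
rewrite -(rmorphM proj (ft K b k) (ft K b k)).
rewrite -(rmorphM proj (ft K b k * ft K b k) (fe K nu)).
exact: (proj_rel (rel_t2 Q k nu)).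
Qed.

Lemma proj_tx k l (nu : seqs_of n b) :
  (tau k * x l - x (stransp k l) * tau k) * e nu =
    proj (if color nu (pos k) == color nu (pos1 k) then
      if l == pos k then - fe K nu else if l == pos1 k then fe K nu else 0
      else 0).
Proof.
apply: etrans (proj_rel (rel_tx Q k l nu)).
exact: esym (morph_commutator proj _ _ _ _ _).
Qed.

Lemma proj_braid (k k1 : 'I_n.-1) (nu : seqs_of n b) : k1 = k.+1 :> nat ->
  (tau k1 * tau k * tau k1 - tau k * tau k1 * tau k) * e nu =
    proj (if color nu (pos k) == color nu (pos1 k1) then
      divdiff (Q (color nu (pos k)) (color nu (pos k1)))
        (fx K b (pos k)) (fx K b (pos k1)) (fx K b (pos1 k1)) * fe K nu
      else 0).
Proof.
move=> kk; apply: etrans (proj_rel (rel_braid Q nu kk)).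
exact: esym (morph_braid proj _ _ _).
Qed.

(** The error y is tau_k x_l - x_(s_k l) tau_k, a signed sum of idempotents. *)
Lemma tau_poly_gen k g : poly_gen g ->
  exists g' y,
    [/\ poly_gen g', poly_part y & tau_nat k * g = g' * tau_nat k + y].
Proof.
move=> cg; case: tau_natP => [i _|]; last first.
  by exists g, 0; split => //; [apply: upto0 | rewrite mul0r mulr0 addr0].
case: cg => [c|nu|l].
- exists (proj c%:MP), 0; split; [exact: poly_scalar | exact: upto0 |].
  by rewrite addr0 proj_scalarC.
- exists (e (move i nu)), 0; split; [exact: poly_e | exact: upto0 |].
  by rewrite addr0 (proj_te proj_rel).
- exists (x (stransp i l)), (tau i * x l - x (stransp i l) * tau i).
  split; [exact: poly_x | | by rewrite addrC subrK].
  apply: poly_part_of_e => nu; rewrite proj_tx.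
  have ce : poly_part (e nu) by apply/upto_base/poly_e.
  do !case: ifP => _; rewrite ?(raddf0 proj) ?(raddfN proj) //;
    try exact: upto0.
  exact: uptoN.
Qed.

Lemma tau_nat_far k l : (k.+1 < l)%N -> GRing.comm (tau_nat k) (tau_nat l).
Proof.
move=> kl; case: tau_natP => [i ik|]; last exact/commr_sym/commr0.
case: tau_natP => [j jl|]; last exact/commr0.
by apply: proj_tt; rewrite ik jl.
Qed.

Lemma tau_nat_sqr k : poly_part (tau_nat k * tau_nat k).
Proof.
case: tau_natP => [i ik|]; last by rewrite mul0r; apply: upto0.
apply: poly_part_of_e => nu; rewrite proj_t2.
by apply: poly_part_projM; [apply: poly_part_eval2 | apply/upto_base/poly_e].
Qed.

Lemma tau_nat_braid k : poly_part (tau_nat k.+1 * tau_nat k * tau_nat k.+1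
  - tau_nat k * tau_nat k.+1 * tau_nat k).
Proof.
case: tau_natP => [j jk|]; last by rewrite !(mul0r, mulr0) subrr; apply: upto0.
case: tau_natP => [i ik|]; last by rewrite !(mul0r, mulr0) subrr; apply: upto0.
have ji : j = i.+1 :> nat by rewrite ik jk.
apply: poly_part_of_e => nu; rewrite proj_braid //.
case: ifP => _; last by rewrite (raddf0 proj); apply: upto0.
by apply: poly_part_projM; [apply: poly_part_divdiff | apply/upto_base/poly_e].
Qed.

Lemma upto_proj f : subring_upto poly_gen tau_nat n.-1 (proj f).
Proof.
elim/freeAlg_ind: f => [c|[[nu|k]|k]|f g|f g].
- exact/upto_base/poly_scalar.
- exact/upto_base/poly_e.
- exact/upto_base/poly_x.
- by rewrite -tau_natE; apply: upto_tau.
- by rewrite (raddfD proj); apply: uptoD.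
- by rewrite (rmorphM proj f g); apply: uptoM.
Qed.
End KLRSpanning.

(** * Bounds on degrees *)
Section DegreeBounds.
Variables (D : cartan_datum) (K : fieldType) (Q : klr_datum D K).
Variables (n : nat) (b : wt D).
Local Notation F := (klr_free K n b).
Variables (R : pzRingType) (proj : {rmorphism F -> R}).
Hypothesis proj_rel : forall f g, klr_rel Q f g -> proj f = proj g.
Hypothesis proj_scalarC : forall c, center R (proj c%:MP).
Hypothesis proj_surj : forall r, exists f, proj f = r.
Variable delta : {rmorphism R -> endo (int -> R)}.
Hypothesis deltaE : forall f, delta (proj f) = coact_free proj f.
Local Notation e nu := (proj (fe K nu)).
Local Notation x k := (proj (fx K b k)).
Local Notation tau k := (proj (ft K b k)).

(** Bounds the degrees of all the generators x_k e(nu) and tau_k e(nu) in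
    absolute value. *)
Definition form_bound : int := \sum_(i : idx D) \sum_j `|root_form i j|.

Lemma root_form_bound (i j : idx D) : `|root_form i j| <= form_bound.
Proof.
rewrite /form_bound (bigD1 i) //= (bigD1 j) //= -addrA lerDl.
by apply: addr_ge0; [apply: sumr_ge0 | do 2!(apply: sumr_ge0 => ? _)].
Qed.

Lemma form_bound_ge0 : 0 <= form_bound.
Proof. by do 2!(apply: sumr_ge0 => ? _). Qed.

Lemma x_deg_gt0 k (nu : seqs_of n b) : 0 < x_deg k nu.
Proof. by rewrite /x_deg /root_form cmat_diag mulr_gt0 // symd_gt0. Qed.

Lemma x_deg_le k (nu : seqs_of n b) : x_deg k nu <= form_bound.
Proof. by apply: le_trans (ler_norm _) (root_form_bound _ _). Qed.

Lemma t_deg_le k (nu : seqs_of n b) : t_deg k nu <= form_bound.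
Proof.
by apply: le_trans (ler_norm _) _; rewrite normrN; apply: root_form_bound.
Qed.

Lemma t_deg_ge k (nu : seqs_of n b) : - form_bound <= t_deg k nu.
Proof.
by rewrite lerN2; apply: le_trans (ler_norm _) (root_form_bound _ _).
Qed.

Local Notation fl := (deg_ge delta).
Local Notation sb := (subring_upto (poly_gen proj) (tau_nat proj)).

Lemma deg_ge_poly_part r : sb 0 r -> fl 0 r.
Proof.
elim=> [|g cg|//|u _ IH|u v _ IHu _ IHv|u v _ IHu _ IHv].
- exact: deg_ge_homog (lexx 0) (homog1 delta).
- case: cg => [c|nu|k].
  + exact: deg_ge_homog (lexx 0) (homog_scalar deltaE c).
  + exact: deg_ge_homog (lexx 0) (homog_e deltaE nu).
  rewrite (mul_sum_e proj_rel (x k)); apply: deg_ge_sum => nu _.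
  exact: deg_ge_homog (ltW (x_deg_gt0 k nu)) (homog_xe proj_rel deltaE k nu).
- exact: deg_geN.
- exact: deg_geD.
- by rewrite -[0]addr0; apply: deg_geM.
Qed.

Lemma deg_ge_tau_nat k : fl (- form_bound) (tau_nat proj k).
Proof.
case: tau_natP => [i _|]; last exact: deg_ge0.
rewrite (mul_sum_e proj_rel (tau i)); apply: deg_ge_sum => nu _.
exact: deg_ge_homog (t_deg_ge i nu) (homog_te proj_rel deltaE i nu).
Qed.

Lemma deg_ge_desc j l : fl (- (form_bound *+ l)) (desc_prod (tau_nat proj) j l).
Proof.
apply: (@deg_ge_le _ _ (- (form_bound *+ (l - j)))).
  by rewrite lerN2 ler_wpMn2l ?form_bound_ge0 // leq_subr.
rewrite /desc_prod -(size_iota j (l - j)) -/(index_iota j l) -size_rev.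
elim: (rev _) => [|k s IHs].
  by rewrite big_nil oppr0; apply: deg_ge_homog (lexx 0) (homog1 delta).
by rewrite big_cons mulrS opprD; apply: deg_geM IHs; apply: deg_ge_tau_nat.
Qed.

(** Each step from q to q + 1 costs at most the degree of a product of q + 1
    factors tau. *)
Lemma upto_deg_ge q : exists c, forall r, sb q r -> fl c r.
Proof.
elim: q => [|q [c IHc]]; first by exists 0; apply: deg_ge_poly_part.
exists (c - form_bound *+ q.+1) => r sr.
have : desc_span (poly_gen proj) (tau_nat proj) q 0 r.
  apply: upto_desc_span sr.
  - exact: tau_poly_gen proj_rel proj_scalarC.
  - exact: tau_nat_far proj_rel.
  - exact: tau_nat_sqr proj_rel.
  - exact: tau_nat_braid proj_rel.
elim=> [|a i u _ sa _ IH]; first exact: deg_ge0.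
by apply: deg_geD => //; apply: deg_geM (deg_ge_desc _ _); apply: IHc.
Qed.

Lemma all_deg_ge : exists c, forall r, fl c r.
Proof.
have [c hc] := upto_deg_ge n.-1; exists c => r; apply: hc.
by have [f <-] := proj_surj r; apply: upto_proj.
Qed.

(** The elements x_k e(nu), tau_k e(nu) and e(nu) generate the ring over central
    scalars, and they are homogeneous of degree at most [form_bound]. *)
Lemma center_of_homog z :
  (forall d h, d <= form_bound -> homog delta d h -> z * h = h * z) ->
  center R z.
Proof.
move=> zh.
have zP r : (forall nu, z * (r * e nu) = r * e nu * z) -> z * r = r * z.
  move=> zr; rewrite (mul_sum_e proj_rel r) mulr_sumr mulr_suml.
  by apply: eq_bigr => nu _; apply: zr.
move=> r; have [f <-] := proj_surj r.
elim/freeAlg_ind: f => [c|[[nu|k]|k]|f g zf zg|f g zf zg].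
- exact/esym/proj_scalarC.
- exact: zh form_bound_ge0 (homog_e deltaE nu).
- apply: zP => nu.
  exact: zh (x_deg_le k nu) (homog_xe proj_rel deltaE k nu).
- apply: zP => nu.
  exact: zh (t_deg_le k nu) (homog_te proj_rel deltaE k nu).
- by rewrite (raddfD proj f g) mulrDr mulrDl zf zg.
- by rewrite (rmorphM proj f g) mulrA zf -mulrA zg mulrA.
Qed.

(** The generator g of the cyclotomic ideal need not be homogeneous, but its
    components are sums of the g * e(nu). *)
Section CyclotomicGenerator.
Variables (k : 'I_n) (m : seqs_of n b -> nat).
Let g := \sum_nu x k ^+ m nu * e nu.

Lemma homog_Xe m' nu : homog delta (x_deg k nu *+ m') (x k ^+ m' * e nu).
Proof.
elim: m' => [|m' IH]; first by rewrite expr0 mul1r; apply: homog_e.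
have -> : x k ^+ m'.+1 * e nu = (x k * e nu) * (x k ^+ m' * e nu).
  have := commr_sym (commrX m' (commr_sym (proj_xe proj_rel k nu))).
  rewrite /GRing.comm => xe.
  rewrite xe mulrA -(mulrA (x k)) (proj_ee proj_rel) eqxx.
  by rewrite -mulrA -xe mulrA exprS.
by rewrite mulrS; apply: homogM IH; apply: (homog_xe proj_rel deltaE).
Qed.

Lemma deg_ge_cyc_gen N : (forall nu, N <= m nu)%N -> fl N%:Z g.
Proof.
move=> Nm; apply: deg_ge_sum => nu _; apply: deg_ge_homog _ (homog_Xe _ _).
have := x_deg_gt0 k nu; rewrite gtz0_ge1 => d1.
rewrite (le_trans _ (ler_wMn2r (m nu) d1)) //.
by rewrite natz lez_nat.
Qed.

Lemma trunc_cyc_gen (I : ideal R) M : I g -> I (trunc delta M g).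
Proof.
move=> Ig; rewrite raddf_sum.
apply: (big_ind I); [exact: ideal0 | exact: idealD |] => nu _ /=.
rewrite (trunc_homog _ (homog_Xe _ _)); case: ifP => _; last exact: ideal0.
have -> : x k ^+ m nu * e nu = g * e nu; last exact: (@Defs.idealMr _ I).
rewrite mulr_suml (bigD1 nu) //= big1 => [|mu mn].
  by rewrite addr0 -mulrA (proj_ee proj_rel) eqxx.
by rewrite -mulrA (proj_ee proj_rel) (negbTE mn) mulr0.
Qed.
End CyclotomicGenerator.
End DegreeBounds.

(** * Lifting central elements *)
Section CentralLifting.
Variables (D : cartan_datum) (K : fieldType) (Q : klr_datum D K).
Variables (n : nat) (b : wt D).
Local Notation R := (KLR Q n b).

(** Centrality in a quotient, stated on representatives in the KLR algebra so
    that quotients at different levels can be compared. *)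
Definition central_mod (L : wt D) (a : R) :=
  forall r, cyc_ideal Q n b L (a * r - r * a).

Lemma central_modP (L : wt D) (a : R) :
  central_mod L a <-> center (cycKLR Q n b L) (cyc_proj Q n b L a).
Proof.
split=> [ca|ca r].
  elim/quotW=> r; rewrite -(rmorphM (cyc_proj Q n b L) a r).
  rewrite -(rmorphM (cyc_proj Q n b L) r a).
  by apply/quot_projP; apply: ca.
apply/quot_projP.
rewrite [LHS](rmorphM (cyc_proj Q n b L) a r).
rewrite [RHS](rmorphM (cyc_proj Q n b L) r a).
exact: ca.
Qed.

Lemma coroot_sum_fweight (j : idx D) (s : seq (idx D)) :
  coroot j (\sum_(i <- s) fweight i) = (count_mem j s)%:Z.
Proof.
elim: s => [|i s IHs]; first by rewrite big_nil raddf0.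
by rewrite big_cons raddfD /= coroot_fweight IHs; case: (i == j).
Qed.

Hypothesis trans_surj : forall (L : wt D) (dL : dominant L) (i : idx D),
  set_surj (center (cycKLR Q n b (L + fweight i))) (center (cycKLR Q n b L))
    (cyc_trans Q n b dL i).

Lemma lift_central1 (L : wt D) i a : dominant L -> central_mod L a ->
  exists a', central_mod (L + fweight i) a' /\ cyc_ideal Q n b L (a' - a).
Proof.
move=> dL /central_modP ca; have [q cq qa] := trans_surj dL i ca.
exists (quot_repr q); split.
  by apply/central_modP; rewrite /cyc_proj quot_reprK.
exact/quot_projP.
Qed.

Lemma lift_central (L : wt D) (s : seq (idx D)) a :
  dominant L -> central_mod L a ->
  exists a', [/\ dominant (L + \sum_(i <- s) fweight i),
    central_mod (L + \sum_(i <- s) fweight i) a' & cyc_ideal Q n b L (a' - a)].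
Proof.
elim: s L a => [|i s IHs] L a dL ca.
  exists a; rewrite big_nil addr0 subrr.
  by split; [exact: dL | exact: ca | exact: ideal0].
have [a1 [ca1 a1a]] := lift_central1 i dL ca.
have [a' [dL' ca' a'a1]] := IHs _ _ (dominant_fweightD i dL) ca1.
exists a'; rewrite big_cons addrA; split; [exact: dL' | exact: ca' |].
have -> : a' - a = (a' - a1) + (a1 - a) by rewrite addrA subrK.
by apply: (idealD (cyc_ideal_fweightD dL a'a1) a1a).
Qed.

(** The truncation argument.  A level L' whose pairings with all the coroots are
    at least N puts the ideal of L' in degrees at least c0 + N + c0, and N is
    chosen to make this exceed the truncation degree M plus [form_bound]. *)
Lemma lift_to_center (L : wt D) a : dominant L -> central_mod L a ->
  exists2 z, center R z & cyc_ideal Q n b L (z - a).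
Proof.
move=> dL ca.
have rel := @klr_relP D K Q n b.
have scC := @klr_scalar_center D K Q n b.
have surj (r : R) : exists f, klr_proj Q f = r.
  by exists (quot_repr r); apply: quot_reprK.
have deltaE := @klr_coactE D K Q n b.
have [c0 all_c0] := all_deg_ge rel scC surj deltaE.
have [M aM] := trunc_above (all_c0 a).
pose N := (absz (M + form_bound D - c0 - c0)%R).+1.
pose s := flatten (nseq N (enum (idx D))).
have [a' [dL' ca' a'a]] := lift_central s dL ca.
set L' := L + _ in dL' ca'.
have L'N j : (N <= `|coroot j L'|)%N.
  rewrite raddfD /= coroot_sum_fweight count_flatten map_nseq sumn_nseq.
  rewrite count_uniq_mem ?enum_uniq // mem_enum mul1n.
  by have := dL j; lia.
have gen_deg_ge g : cyc_gen L' g -> deg_ge (klr_coact Q n b) N%:Z g.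
  case=> n_gt0 /= ->; apply: (deg_ge_cyc_gen rel deltaE) => nu; exact: L'N.
have trunc_gen g M' :
    cyc_gen L g -> cyc_ideal Q n b L (trunc (klr_coact Q n b) M' g).
  move=> Lg; case: (Lg) => n_gt0 /= gE; have := ideal_gen_sub Lg; rewrite gE.
  exact: (trunc_cyc_gen rel deltaE).
exists (trunc (klr_coact Q n b) M a').
  apply: (trunc_center all_c0 (center_of_homog rel scC surj deltaE)) ca'.
    exact: ideal_gen_deg_ge gen_deg_ge.
  by rewrite /N; lia.
by rewrite -{1}aM -raddfB; apply: ideal_gen_trunc.
Qed.
End CentralLifting.

Theorem theorem2p1 (D : cartan_datum) (K : fieldType) (Q : klr_datum D K)
    (n : nat) (b : wt D) (Qb : Qplus n b) :
  (forall L : wt D, dominant L ->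
     set_surj (center (KLR Q n b)) (center (cycKLR Q n b L)) (cyc_proj Q n b L))
  <->
  (forall (L : wt D) (dL : dominant L) (i : idx D),
     set_surj (center (cycKLR Q n b (L + fweight i))) (center (cycKLR Q n b L))
       (cyc_trans Q n b dL i)).
Proof.
split=> [proj_surj L dL i q cq | trans_surj L dL q cq].
  have [z cz zq] := proj_surj L dL q cq.
  exists (cyc_proj Q n b (L + fweight i) z); first exact: cyc_proj_center.
  by rewrite cyc_transE.
have ca : central_mod L (quot_repr q).
  by apply/central_modP; rewrite /cyc_proj quot_reprK.
have [z cz zq] := lift_to_center trans_surj dL ca.
exists z => //; rewrite -[q]quot_reprK; exact/quot_projP.
Qed.
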